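(* Among all connected bipartite graphs of order $n\geq 3$, the complete bipartite graph $K_{\lfloor\frac{n}{2}\rfloor,\lceil\frac{n}{2}\rceil}$ has the minimum distance Laplacian energy; that is, for every connected bipartite graph $G$ of order $n\ge 3$, $DLE(G)\ge DLE\big(K_{\lfloor\frac{n}{2}\rfloor,\lceil\frac{n}{2}\rceil}\big)$.
   Context: All graphs are simple and finite. For a connected graph $G$ of order $n$: $d_{uv}$ is the length of a shortest path between $u$ and $v$; the transmission of $v$ is $Tr_G(v)=\sum_{u} d_{uv}$; the Wiener index is $W(G)=\frac12\sum_v Tr_G(v)$. The distance Laplacian matrix is $D^L(G)=Tr(G)-D(G)$, where $D(G)=(d_{uv})$ and $Tr(G)$ is the diagonal matrix of transmissions; its eigenvalues $\rho_1^L\ge\dots\ge\rho_n^L$ (with multiplicity) are the distance Laplacian eigenvalues, and the distance Laplacian energy is $DLE(G)=\sum_{i=1}^n\left|\rho_i^L-\frac{2W(G)}{n}\right|$. $K_{a,b}$ is the complete bipartite graph with parts of size $a$ and $b$. *)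

(* Defs.v *)
From mathcomp Require Import all_boot all_order all_algebra.
From mathcomp Require Import polyrcf.

Set Implicit Arguments.
Unset Strict Implicit.
Unset Printing Implicit Defensive.

Import Order.TTheory GRing.Theory Num.Theory.

Record sgraph := SGraph {
  svertex :> finType;
  sedge : rel svertex;
  sedge_sym : symmetric sedge;
  sedge_irrefl : irreflexive sedge
}.

Definition order_of (G : sgraph) : nat := #|svertex G|.

Definition connected (G : sgraph) : Prop :=
  forall u v : G, connect (@sedge G) u v.

Definition bipartite (G : sgraph) : Prop :=
  exists A : {set G}, forall u v : G, sedge u v -> (u \in A) != (v \in A).

Definition has_path (G : sgraph) (u v : G) (k : nat) : bool :=
  [exists p : k.-tuple G,
    [&& path (@sedge G) u p, last u p == v & uniq (u :: p)]].

(* A path has fewer edges than the graph has vertices, so the search range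
   contains every possible length.  When no path joins [u] and [v] the value
   is the junk [#|G|], which does not occur in a connected graph. *)
Definition gdist (G : sgraph) (u v : G) : nat :=
  find (has_path u v) (iota 0 #|G|).

Definition transmission (G : sgraph) (v : G) : nat := \sum_(u : G) gdist u v.

Section DistanceLaplacian.

Local Open Scope ring_scope.

Variable R : rcfType.

Definition wiener (G : sgraph) : R :=
  2%:R^-1 * \sum_(v : G) (transmission v)%:R.

(* The vertices are ordered by [enum_val]; another ordering would conjugate
   the matrices below by a permutation matrix. *)
Definition dist_mx (G : sgraph) : 'M[R]_#|G| :=
  \matrix_(i, j) (gdist (enum_val i) (enum_val j))%:R.

Definition transmission_mx (G : sgraph) : 'M[R]_#|G| :=
  diag_mx (\row_i (transmission (enum_val i))%:R).

Definition dist_lap_mx (G : sgraph) : 'M[R]_#|G| :=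
  transmission_mx G - dist_mx G.

(* The eigenvalues of [M] lying in [R], in nonincreasing order, each repeated
   according to its algebraic multiplicity.  For a symmetric [M] the
   characteristic polynomial splits over the real closed field [R], so this
   is the full list of [n] eigenvalues. *)
Definition eigenvalues (n : nat) (M : 'M[R]_n) : seq R :=
  let p := char_poly M in
  rev (flatten [seq nseq (mup x p) x | x <- rootsR p]).

Definition DLE (G : sgraph) : R :=
  \sum_(rho <- eigenvalues (dist_lap_mx G))
    `|rho - 2%:R * wiener G / (order_of G)%:R|.

End DistanceLaplacian.

Definition Kab_edge (a b : nat) : rel ('I_a + 'I_b)%type :=
  fun u v => match u, v with
             | inl _, inr _ | inr _, inl _ => true
             | _, _ => false
             end.

Lemma Kab_edge_sym (a b : nat) : symmetric (@Kab_edge a b).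
Proof. by move=> [u|u] [v|v]. Qed.

Lemma Kab_edge_irrefl (a b : nat) : irreflexive (@Kab_edge a b).
Proof. by move=> [u|u]. Qed.

Definition Kab (a b : nat) : sgraph :=
  SGraph (@Kab_edge_sym a b) (@Kab_edge_irrefl a b).

(* Main.v *)
Require Import Defs.
From mathcomp Require Import all_boot all_order all_algebra.
From mathcomp Require Import polyrcf complex ring lra zify.

(** Let [p <= q] be the sizes of the two sides of [G], [n = p + q], [L] the
    distance Laplacian and [t] its mean eigenvalue.  Since [L - t] has trace
    zero and sends [1] to [- t 1], the energy is at least
    [2 t - 2 (z (L - t) z / |z|^2 + y (L - t) y / |y|^2)] for [z], [y], [1]
    pairwise orthogonal.  For the balanced complete bipartite graph the energy
    is [4 n - 8] ([n] even) or [4 n - 8 + 2 / n] ([n] odd), and [16 / 3] when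
    [n = 3].  Measure [G] by the excess of its distances over those of
    [K_{p,q}].  Averaging [z = e_u - 1 / n] over the vertices settles the case
    of a total excess at least [p q] (at least [p q + 1] when [n] is odd), and
    [z] equal to [q] on one side and [- p] on the other settles the rest, except
    when [n] is odd and every distance is [2] inside a side and [1] or [3]
    across.  There, on the orthogonal of [1], [L] is [2 n] plus the Laplacian of
    the signed bipartite graph with weights [eps = d - 2], which an energy below
    the target would force to be nearly nonnegative.  Edges and a perturbation
    of [z] used as test vectors then show that [eps] has nearly constant degrees
    and sum [sigma] with [n - 1 < - 2 sigma].  If [q = p + 1] this contradicts
    the integrality of the degrees; if [q >= p + 3] it contradicts the Schur
    product theorem, which bounds the Frobenius norm of the centred [eps] by
    that of the centred degrees. *)

Set Implicit Arguments.
Unset Strict Implicit.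
Unset Printing Implicit Defensive.

Import Order.TTheory GRing.Theory Num.Theory.
Local Open Scope ring_scope.

(** * Real symmetric matrices *)

Lemma similar_char_poly (F : fieldType) n (P A B : 'M[F]_n) :
  P \in unitmx -> P *m A = B *m P -> char_poly A = char_poly B.
Proof.
move=> unitP PA; have detP : (\det P)%:P != 0.
  by rewrite polyC_eq0 -unitfE -unitmxE.
apply: (mulfI detP); rewrite /char_poly -[(\det P)%:P]det_map_mx.
rewrite -det_mulmx mulrC -det_mulmx; congr (\det _).
rewrite /char_poly_mx mulmxBr mulmxBl -!map_mxM PA.
by rewrite scalar_mxC.
Qed.

Section SymmetricSpectrum.
Variable R : rcfType.
Local Open Scope sesquilinear_scope.

(** Once the characteristic polynomial splits as a product over [s], its distinct roots are those of
    [undup s] and [mup] is [count_mem], so the list built from [rootsR] regroups [s]. *)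
Lemma perm_eigenvalues n (A : 'M[R]_n) (s : seq R) :
  char_poly A = \prod_(x <- s) ('X - x%:P) -> perm_eq (eigenvalues A) s.
Proof.
move=> cpA; rewrite /eigenvalues perm_rev.
apply: perm_trans (perm_count_undup s).
have p_neq0 : char_poly A != 0 by rewrite monic_neq0 ?char_poly_monic.
have -> : [seq nseq (mup x (char_poly A)) x | x <- rootsR (char_poly A)]
        = [seq nseq (count_mem x s) x | x <- rootsR (char_poly A)].
  by apply: eq_map => x; rewrite cpA mu_prod_XsubC.
apply: perm_flatten; apply: perm_map.
apply: uniq_perm; rewrite ?undup_uniq ?uniq_roots // => x.
rewrite mem_undup -(root_prod_XsubC s) -cpA.
by have := roots_on_rootsR p_neq0 x; rewrite in_itv /= => <-.
Qed.

(* The real and imaginary parts of the rows of a unitary diagonaliser form a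
   tight frame of real eigenvectors, which serves as an orthonormal eigenbasis
   would. *)
Lemma symmetric_eigenframe n (A : 'M[R]_n) : A^T = A ->
  exists (lam : 'I_n -> R) (f : 'I_n * bool -> 'I_n -> R),
  [/\ perm_eq (eigenvalues A) [seq lam i | i <- enum 'I_n],
      forall k u, \sum_v A u v * f k v = lam k.1 * f k u,
      forall u v, \sum_k f k u * f k v = (u == v)%:R &
      forall i, \sum_u f (i, false) u ^+ 2 + \sum_u f (i, true) u ^+ 2 = 1].
Proof.
move=> symA; pose AC := map_mx (real_complex R) A.
have hermA : AC \is hermsymmx.
  apply: realsym_hermsym.
    by apply/is_hermitianmxP; rewrite expr0 scale1r map_mx_id // map_trmx symA.
  by apply/mxOverP => i j; rewrite mxE complex_real.
have /orthomx_spectralP := hermitian_normalmx hermA.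
have /mxOverP := hermitian_spectral_diag_real hermA.
have := spectral_unitarymx AC.
set P := spectralmx AC; set sp := spectral_diag AC => unP sp_real eqA.
pose lam i := complex.Re (sp 0 i).
have spE i : sp 0 i = (lam i)%:C%C by rewrite /lam RRe_real.
pose f (k : 'I_n * bool) u :=
  if k.2 then complex.Im (P k.1 u) else complex.Re (P k.1 u).
have unitP : P \in unitmx by exact: unitarymx_unit.
have PA : P *m AC = diag_mx sp *m P.
  by rewrite eqA !mulmxA mulmxV // mul1mx.
exists lam, f; split.
- apply: perm_eigenvalues; rewrite big_map big_enum /=.
  apply: (map_poly_inj (real_complex R)).
  rewrite map_char_poly map_prod_XsubC -/AC.
  rewrite (similar_char_poly unitP PA) char_poly_trig ?diag_mx_is_trig //.
  by apply: eq_bigr => i _; rewrite mxE eqxx mulr1n spE.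
- case=> i b u; have /matrixP /(_ i u) := PA.
  rewrite mul_diag_mx !mxE spE => PAiu.
  transitivity (\sum_v f (i, b) v * A v u).
    apply: eq_bigr => v _; rewrite mulrC; congr (_ * _).
    by rewrite -[in LHS]symA mxE.
  rewrite /f /=; case: b.
    have /(congr1 (@complex.Im R)) := PAiu; rewrite raddf_sum /= => sE.
    transitivity (\sum_v complex.Im (P i v * AC v u)).
      by apply: eq_bigr => v _; rewrite mxE; case: (P i v) => a b /=; ring.
    by rewrite sE; case: (P i u) => a b /=; ring.
  have /(congr1 (@complex.Re R)) := PAiu; rewrite raddf_sum /= => sE.
  transitivity (\sum_v complex.Re (P i v * AC v u)).
    by apply: eq_bigr => v _; rewrite mxE; case: (P i v) => a b /=; ring.
  by rewrite sE; case: (P i u) => a b /=; ring.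
(* The columns of [P] are orthonormal too, and the real part of a Hermitian product of entries is
   the sum of the products of their real and of their imaginary parts. *)
- move=> u v; have /unitarymxP := unP => /mulmx1C /matrixP /(_ u v).
  rewrite !mxE => /(congr1 (@complex.Re R)); rewrite raddf_sum /= => sE.
  have -> : (u == v)%:R = complex.Re ((u == v)%:R : R[i]) :> R.
    by case: (u == v).
  rewrite -sE; pose h i b := f (i, b) u * f (i, b) v.
  transitivity (\sum_i \sum_b h i b).
    by rewrite pair_bigA; apply: eq_bigr => -[].
  apply: eq_bigr => i _; rewrite big_bool /h /f /= !mxE.
  by case: (P i u) => a b; case: (P i v) => c d /=; ring.
- move=> i; have /unitarymxP /matrixP /(_ i i) := unP.
  rewrite !mxE eqxx => /(congr1 (@complex.Re R)); rewrite raddf_sum /= => sE.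
  rewrite -[RHS]sE -big_split /=; apply: eq_bigr => u _.
  by rewrite /f /= !mxE; case: (P i u) => a b /=; ring.
Qed.
End SymmetricSpectrum.

(** * Distances in connected bipartite graphs *)

Section GraphDistance.
Variable G : sgraph.
Implicit Types u v w : G.

Lemma has_pathP u v k :
  reflect (exists p : seq G, [/\ size p = k, path (@sedge G) u p, last u p = v
                               & uniq (u :: p)])
          (has_path u v k).
Proof.
apply: (iffP existsP) => [[p /and3P[pp /eqP lp up]]|[p [sp pp lp up]]].
  by exists p; split; rewrite ?size_tuple.
by exists (Tuple (introT eqP sp)); apply/and3P; split; rewrite ?lp.
Qed.

Lemma has_path_sym u v k : has_path u v k = has_path v u k.
Proof.
suff sub (x y : G) : has_path x y k -> has_path y x k by apply/idP/idP; apply: sub.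
move=> /has_pathP [p [sp pp lp up]]; apply/has_pathP.
exists (rev (belast x p)); split.
- by rewrite size_rev size_belast.
- rewrite -lp rev_path; apply: sub_path pp => a b /=.
  by rewrite sedge_sym.
- by rewrite -lp; case: p {sp pp lp up} => [|a p] //=; rewrite rev_cons last_rcons.
- by rewrite -lp -rev_rcons -lastI rev_uniq.
Qed.

Lemma gdist_sym u v : gdist u v = gdist v u.
Proof. by apply: eq_find => k; apply: has_path_sym. Qed.

(** A walk shortens to a path without repeated vertices, whose length is below [#|G|] and hence in
    the range searched by [find]. *)
Lemma gdist_le_path u p : path (@sedge G) u p -> (gdist u (last u p) <= size p)%N.
Proof.
move=> pp; case: (shortenP pp) => q pq uq subqp.
apply: (@leq_trans (size q)); last first.
  by apply: uniq_leq_size => //; case/andP: uq.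
have ltq : (size q < #|G|)%N.
  by have /card_uniqP /= <- := uq; apply: max_card.
rewrite leqNgt; apply/negP => lt_find.
have := @before_find _ 0%N (has_path u (last u q)) (iota 0 #|G|) _ lt_find.
by rewrite nth_iota // add0n => /has_pathP []; exists q.
Qed.

(** Connectedness supplies a simple path, so [find] stops at a genuine length and never returns the
    junk value. *)
Lemma gdistP u v : connected G ->
  exists p, [/\ path (@sedge G) u p, last u p = v & size p = gdist u v].
Proof.
move=> conG; have /connectP[p0 pp0 ->] := conG u v.
have le_p := gdist_le_path.
case: (shortenP pp0) => q pq uq _.
have ltq : (size q < #|G|)%N.
  by have /card_uniqP /= <- := uq; apply: max_card.
have hq : has (has_path u (last u q)) (iota 0 #|G|).
  by apply/hasP; exists (size q); rewrite ?mem_iota //; apply/has_pathP; exists q.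
have := nth_find 0%N hq; rewrite has_find size_iota in hq.
by rewrite nth_iota // add0n => /has_pathP [p [? ? ? _]]; exists p.
Qed.

Lemma gdist_refl u : gdist u u = 0%N.
Proof. by apply/eqP; rewrite -leqn0 (@gdist_le_path u [::]). Qed.

Lemma gdist_edge u v : sedge u v -> (gdist u v <= 1)%N.
Proof. by move=> uv; apply: (@gdist_le_path u [:: v]); rewrite /= uv. Qed.

Lemma gdist_step u v w : connected G -> sedge u w ->
  (gdist u v <= (gdist w v).+1)%N.
Proof.
move=> conG uw; have [p [pp <- <-]] := gdistP w v conG.
by apply: (@gdist_le_path u (w :: p)); rewrite /= uw.
Qed.

Lemma gdist_gt0 u v : connected G -> u != v -> (0 < gdist u v)%N.
Proof.
move=> conG; apply: contraNltn; rewrite leqn0 => /eqP d0.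
by have [[|w p] [_ /= lp]] := gdistP u v conG; rewrite d0 // lp eqxx.
Qed.

Variable A : {set G}.
Hypothesis bipA : forall u v, sedge u v -> (u \in A) != (v \in A).

Lemma odd_gdist u v : connected G -> odd (gdist u v) = ((u \in A) != (v \in A)).
Proof.
move=> conG; have [p [+ <- <-]] := gdistP u v conG.
elim: p u => [|w p IH] u /=; first by rewrite eqxx.
move=> /andP[/bipA uw /IH ->]; move: uw.
by case: (u \in A); case: (w \in A); case: (_ \in A).
Qed.

Lemma sides_nonempty u v : connected G -> u != v ->
  exists2 w, w \in A & exists w', w' \notin A.
Proof.
move=> conG uv.
have [[|w p] [/= pp lp _]] := gdistP u v conG; first by rewrite lp eqxx in uv.
have /andP[/bipA uw _] := pp.
case: (boolP (u \in A)) => uA; first by exists u => //; exists w; rewrite uA in uw.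
by exists w; [case: (w \in A) uw; rewrite (negPf uA) | exists u].
Qed.

End GraphDistance.

(** * Variational bounds on the energy *)

Section Forms.
Variables (R : rcfType) (T : finType).
Implicit Types (f g z : T -> R) (D : T -> T -> R).

Definition dot f g := \sum_u f u * g u.

Definition lapform D z := 2^-1 * \sum_u \sum_v D u v * (z u - z v) ^+ 2.

Definition mean_trans D := (\sum_u \sum_v D u v) / #|T|%:R.

Lemma dotC f g : dot f g = dot g f.
Proof. by apply: eq_bigr => u _; rewrite mulrC. Qed.

Lemma dot_ge0 f : 0 <= dot f f.
Proof. by apply: sumr_ge0 => u _; rewrite -expr2 sqr_ge0. Qed.

Lemma dotDl f g z : dot (fun u => f u + g u) z = dot f z + dot g z.
Proof. by rewrite -big_split; apply: eq_bigr => u _; rewrite mulrDl. Qed.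

Lemma dotZl a f z : dot (fun u => a * f u) z = a * dot f z.
Proof. by rewrite mulr_sumr; apply: eq_bigr => u _; rewrite mulrA. Qed.

Lemma dot_eq0 f : dot f f = 0 -> forall u, f u = 0.
Proof.
move=> /eqP; rewrite psumr_eq0 => [/allP f0 u|u _]; last by rewrite -expr2 sqr_ge0.
by have := f0 u (mem_index_enum u); rewrite -expr2 sqrf_eq0 => /eqP.
Qed.

Lemma dot0 f z : dot f f = 0 -> dot z f = 0.
Proof. by move=> /dot_eq0 f0; apply: big1 => u _; rewrite f0 mulr0. Qed.

(** Expand the square of [f - a z - b y], with [a] and [b] the Fourier coefficients. For a null
    vector the coefficient is [0] by the convention [x / 0 = 0], and its term vanishes. *)
Lemma Bessel2 f z y : dot z y = 0 ->
  dot f z ^+ 2 / dot z z + dot f y ^+ 2 / dot y y <= dot f f.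
Proof.
move=> zy0; set a := dot f z / dot z z; set b := dot f y / dot y y.
have az : a * dot z z = dot f z.
  have [z0|zn] := eqVneq (dot z z) 0; first by rewrite z0 mulr0 (dot0 _ z0).
  by rewrite mulfVK.
have by_ : b * dot y y = dot f y.
  have [y0|yn] := eqVneq (dot y y) 0; first by rewrite y0 mulr0 (dot0 _ y0).
  by rewrite mulfVK.
have := dot_ge0 (fun u => f u + (- a * z u + - b * y u)).
rewrite !(dotDl, dotZl) !(dotC _ (fun u => _ + _)) !(dotDl, dotZl).
rewrite (dotC z f) (dotC y f) (dotC y z) zy0 => h.
have -> : dot f z ^+ 2 / dot z z = a * dot f z by rewrite /a expr2 mulrAC.
have -> : dot f y ^+ 2 / dot y y = b * dot f y by rewrite /b expr2 mulrAC.
by move: h; rewrite -az -by_; nra.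
Qed.

End Forms.

Section Energy.
Variables (R : rcfType) (G : sgraph).
Local Notation D := (fun u v : G => (gdist u v)%:R : R).
Local Notation t := (mean_trans D).
Local Notation Q := (lapform D).

(** The eigenframe carried over to vertices. Each eigenvalue is indexed twice, and the squared norms
    of its two frame vectors add up to [1]; these norms therefore act as weights in the energy and
    in the trace. *)
Lemma DLE_eigenframe : exists (K : finType) (lam : K -> R) (f : K -> G -> R),
  [/\ DLE R G = \sum_k `|lam k - t| * dot (f k) (f k),
      forall k, Q (f k) = lam k * dot (f k) (f k),
      forall z, \sum_k lam k * dot (f k) z ^+ 2 = Q z,
      forall z, \sum_k dot (f k) z ^+ 2 = dot z z &
      \sum_k (lam k - t) * dot (f k) (f k) = 0].
Proof.
pose A (x y : G) : R := (x == y)%:R * (transmission x)%:R - (gdist x y)%:R.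
have transE x : (transmission x)%:R = \sum_v D x v :> R.
  by rewrite natr_sum; apply: eq_bigr => v _; rewrite gdist_sym.
have quadA z : \sum_x \sum_y A x y * z x * z y = Q z.
  pose sA := \sum_x (transmission x)%:R * z x ^+ 2 : R.
  pose sD := \sum_x \sum_y D x y * z x * z y.
  have -> : \sum_x \sum_y A x y * z x * z y = sA - sD.
    rewrite -sumrB; apply: eq_bigr => x _.
    rewrite (eq_bigr (fun y => (x == y)%:R * (transmission x)%:R * z x * z y
       - D x y * z x * z y)) => [|y _]; last by rewrite /A; ring.
    rewrite sumrB (bigD1 x) //= eqxx big1 ?addr0 => [|y].
      by congr (_ - _); rewrite mul1r -mulrA.
    by rewrite eq_sym => /negPf->; rewrite !mul0r.
  have sAl : sA = \sum_x \sum_y D x y * z x ^+ 2.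
    by apply: eq_bigr => x _; rewrite transE mulr_suml.
  have sAr : sA = \sum_x \sum_y D x y * z y ^+ 2.
    rewrite sAl exchange_big; apply: eq_bigr => x _; apply: eq_bigr => y _.
    by rewrite gdist_sym.
  rewrite /lapform (eq_bigr (fun x => \sum_y D x y * z x ^+ 2
     + \sum_y D x y * z y ^+ 2 - 2 * \sum_y D x y * z x * z y)); last first.
    move=> x _; rewrite mulr_sumr -big_split -sumrB /=; apply: eq_bigr => y _.
    by ring.
  rewrite sumrB big_split /= -sAl -sAr -mulr_sumr -/sD.
  by lra.
have symL : (dist_lap_mx R G)^T = dist_lap_mx R G.
  apply/matrixP => i j; rewrite !mxE eq_sym (gdist_sym (enum_val j)).
  by case: eqP => [->|_]; rewrite ?mulr0n.
have [lam [f [permL eigL ONf nf]]] := symmetric_eigenframe symL.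
have LE x y : dist_lap_mx R G (enum_rank x) (enum_rank y) = A x y.
  rewrite !mxE !enum_rankK /A (inj_eq enum_rank_inj).
  by case: (x == y); rewrite ?mul1r ?mul0r ?mulr1n ?mulr0n.
pose F k (x : G) := f k (enum_rank x).
have reindexG (h : 'I_#|G| -> R) : \sum_i h i = \sum_(x : G) h (enum_rank x).
  by rewrite (reindex _ (onW_bij _ (enum_rank_bij G))).
have eigF k x : \sum_y A x y * F k y = lam k.1 * F k x.
  rewrite -eigL reindexG; apply: eq_bigr => y _.
  by rewrite LE.
have ONF x y : \sum_k F k x * F k y = (x == y)%:R.
  by rewrite ONf (inj_eq enum_rank_inj).
exists ('I_#|G| * bool)%type, (fun k => lam k.1), F.
have dotF k z : dot (F k) z ^+ 2 = \sum_x \sum_y F k x * F k y * z x * z y.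
  rewrite expr2 /dot mulr_suml; apply: eq_bigr => x _.
  by rewrite mulr_sumr; apply: eq_bigr => y _; ring.
have exK (h : 'I_#|G| * bool -> G -> G -> R) :
  \sum_k \sum_x \sum_y h k x y = \sum_x \sum_y \sum_k h k x y.
  by rewrite exchange_big; apply: eq_bigr => x _; rewrite exchange_big.
have sum_dot : \sum_k dot (F k) (F k) = #|G|%:R.
  rewrite exchange_big /= (eq_bigr (fun=> 1)) => [|x _]; last by rewrite ONF eqxx.
  by rewrite sumr_const.
have lamA x y : \sum_k lam k.1 * (F k x * F k y) = A x y.
  rewrite (eq_bigr (fun k => \sum_w A x w * (F k w * F k y))); last first.
    move=> k _; rewrite mulrA -eigF mulr_suml.
    by apply: eq_bigr => w _; rewrite mulrA.
  rewrite exchange_big /= (bigD1 y) //= -mulr_sumr ONF eqxx mulr1.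
  rewrite big1 ?addr0 // => w wy.
  by rewrite -mulr_sumr ONF (negPf wy) mulr0.
split.
- rewrite /DLE (perm_big _ permL) /= big_map big_enum /=.
  have -> : 2%:R * wiener R G / (order_of G)%:R = t.
    rewrite /wiener mulrA divff ?mul1r ?pnatr_eq0 //.
    by congr (_ / _); apply: eq_bigr => x _; rewrite transE.
  transitivity (\sum_i \sum_b `|lam i - t| * dot (F (i, b)) (F (i, b))); last first.
    by rewrite pair_bigA; apply: eq_bigr => -[].
  apply: eq_bigr => i _; rewrite big_bool /= -mulrDr -[LHS]mulr1; congr (_ * _).
  rewrite -(nf i) addrC; congr (_ + _); rewrite reindexG; apply: eq_bigr => x _;
    by rewrite expr2.
- move=> k; rewrite -quadA /dot mulr_sumr; apply: eq_bigr => x _.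
  rewrite mulrA -eigF mulr_suml; apply: eq_bigr => y _.
  by rewrite -mulrA [F k x * _]mulrC mulrA.
- move=> z; rewrite -quadA.
  under eq_bigr do rewrite dotF mulr_sumr.
  under eq_bigr do under eq_bigr do rewrite mulr_sumr.
  rewrite exK; apply: eq_bigr => x _; apply: eq_bigr => y _.
  by rewrite -lamA !mulr_suml; apply: eq_bigr => k _; ring.
- move=> z; under eq_bigr do rewrite dotF.
  rewrite exK; apply: eq_bigr => x _.
  under eq_bigr do rewrite -!mulr_suml ONF.
  rewrite (bigD1 x) //= eqxx big1 ?addr0 ?mul1r // => y.
  by rewrite eq_sym => /negPf->; rewrite !mul0r.
- under eq_bigr do rewrite mulrBl.
  rewrite sumrB -mulr_sumr sum_dot.
  have -> : \sum_k lam k.1 * dot (F k) (F k) = \sum_x \sum_v D x v.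
    under eq_bigr do rewrite mulr_sumr.
    rewrite exchange_big; apply: eq_bigr => x _ /=.
    by rewrite lamA /A eqxx mul1r gdist_refl subr0 transE.
  rewrite /mean_trans; have [n0|nn] := eqVneq (#|G|%:R : R) 0; last first.
    by rewrite divfK ?subrr.
  rewrite n0 mulr0 subr0 big1 // => x.
  by move/eqP: n0; rewrite pnatr_eq0 => /eqP/card0_eq /(_ x); rewrite inE.
Qed.

(* Testing against [1 - 2 P], with [P] the projection on the span of [1], [z]
   and [y]; a null [z] or [y] contributes nothing since [x / 0 = 0]. *)
Lemma DLE_lower (z y : G -> R) : (0 < #|G|)%N ->
  \sum_u z u = 0 -> \sum_u y u = 0 -> dot z y = 0 ->
  2 * t - 2 * ((Q z - t * dot z z) / dot z z)
        - 2 * ((Q y - t * dot y y) / dot y y) <= DLE R G.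
Proof.
move=> G0 z1 y1 zy.
have [K [lam [f [-> eigQ quadQ quad1 tr0]]]] := DLE_eigenframe.
pose e (_ : G) : R := 1.
(* [w k] is the squared length of the projection of [f k] on the span of [1], [z] and [y]. *)
pose w k := dot (f k) e ^+ 2 / dot e e + dot (f k) z ^+ 2 / dot z z
            + dot (f k) y ^+ 2 / dot y y.
have e_neq0 : dot e e != 0.
  rewrite /dot /e; under eq_bigr do rewrite mulr1.
  by rewrite sumr_const pnatr_eq0 -lt0n.
have w_ge0 k : 0 <= w k.
  by rewrite !addr_ge0 // divr_ge0 ?sqr_ge0 ?dot_ge0.
(* Bessel for [z] and [y] is applied to [f k] minus its component along [1]. *)
have w_le k : w k <= dot (f k) (f k).
  pose a := dot (f k) e / dot e e.
  have ze : dot e z = 0 by rewrite /dot /e; under eq_bigr do rewrite mul1r.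
  have ye : dot e y = 0 by rewrite /dot /e; under eq_bigr do rewrite mul1r.
  have := Bessel2 (fun u => f k u + - a * e u) zy.
  rewrite !(dotDl, dotZl) !(dotC _ (fun u => _ + _)) !(dotDl, dotZl).
  rewrite (dotC e (f k)) ze ye !mulr0 !addr0 => h.
  have aE : dot (f k) e ^+ 2 / dot e e = a * dot (f k) e by rewrite expr2 mulrAC.
  have aE2 : a * dot e e = dot (f k) e by rewrite mulfVK.
  by move: h; rewrite /w aE -aE2; set q := _ / dot z z; set q' := _ / dot y y; lra.
have sum_quad z0 : \sum_k (lam k - t) * (dot (f k) z0 ^+ 2 / dot z0 z0)
                 = (Q z0 - t * dot z0 z0) / dot z0 z0.
  under eq_bigr do rewrite mulrA mulrBl.
  by rewrite -mulr_suml sumrB -mulr_sumr quadQ quad1.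
have Qe : Q e = 0.
  rewrite /lapform big1 ?mulr0 // => u _; rewrite big1 // => v _.
  by rewrite subrr expr0n mulr0.
have -> : 2 * t - 2 * ((Q z - t * dot z z) / dot z z)
        - 2 * ((Q y - t * dot y y) / dot y y)
   = \sum_k (lam k - t) * (dot (f k) (f k) - 2 * w k).
  under eq_bigr do rewrite mulrBr.
  rewrite sumrB tr0 sub0r.
  under eq_bigr do rewrite mulrCA /w !mulrDr.
  rewrite !big_split /= -!mulr_sumr !sum_quad Qe.
  by rewrite sub0r mulNr mulfK //; ring.
(* Termwise: [0 <= w <= x] puts [x - 2 w] between [- x] and [x]. *)
apply: ler_sum => k _.
have := w_le k; have := w_ge0 k; set x := dot _ _; set m := lam k - t.
move=> h1 h2.
have [m0|m0] := leP 0 m.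
  by rewrite ger0_norm // ler_wpM2l //; lra.
by rewrite ltr0_norm //; nra.
Qed.

(* The rank two form with weights [b1], [b2] dominates the negative part of
   [L - t], and half the energy is the trace of that part. *)
Lemma DLE_upper (b1 b2 : R) (w1 w2 : G -> R) : 0 <= b1 -> 0 <= b2 ->
  (forall f, 0 <= Q f - t * dot f f + b1 * dot f w1 ^+ 2 + b2 * dot f w2 ^+ 2) ->
  DLE R G <= 2 * (b1 * dot w1 w1 + b2 * dot w2 w2).
Proof.
move=> b10 b20 posM.
have [K [lam [f [-> eigQ quadQ quad1 tr0]]]] := DLE_eigenframe.
have -> : b1 * dot w1 w1 + b2 * dot w2 w2 =
    \sum_k (b1 * dot (f k) w1 ^+ 2 + b2 * dot (f k) w2 ^+ 2).
  by rewrite big_split -!mulr_sumr !quad1.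
rewrite mulr_sumr; set S := (X in _ <= X).
have -> : S = \sum_k ((lam k - t) * dot (f k) (f k)
    + 2 * (b1 * dot (f k) w1 ^+ 2 + b2 * dot (f k) w2 ^+ 2)).
  by rewrite big_split /= tr0 add0r.
(* Where [m < 0] the hypothesis bounds [- m x] by the rank two form; where [m >= 0] that form is
   just added. *)
apply: ler_sum => k _.
have := posM (f k); rewrite eigQ.
have := mulr_ge0 b10 (sqr_ge0 (dot (f k) w1)).
have := mulr_ge0 b20 (sqr_ge0 (dot (f k) w2)).
have := dot_ge0 (f k); set x := dot (f k) (f k); set m := lam k - t.
have -> : lam k = m + t by rewrite /m; ring.
by have [m0|m0] := leP 0 m; [rewrite ger0_norm | rewrite ltr0_norm]; lra.
Qed.

End Energy.

(** * The complete bipartite graph *)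

Lemma sum_constr (R : pzRingType) (I : finType) (c : R) : \sum_(i : I) c = #|I|%:R * c.
Proof. by rewrite sumr_const mulr_natl. Qed.

Lemma sqr_sum_le (R : realFieldType) (I : finType) (a : I -> R) :
  (\sum_i a i) ^+ 2 <= #|I|%:R * \sum_i a i ^+ 2.
Proof.
set s := \sum_i a i; set k : R := #|I|%:R.
have : 0 <= \sum_i (k * a i - s) ^+ 2 by apply: sumr_ge0 => i _; rewrite sqr_ge0.
have -> : \sum_i (k * a i - s) ^+ 2 = k * (k * (\sum_i a i ^+ 2) - s ^+ 2).
  rewrite (eq_bigr (fun i => k ^+ 2 * a i ^+ 2 - 2 * k * s * a i + s ^+ 2));
    last by move=> i _; ring.
  rewrite big_split sumrB /= -!mulr_sumr sumr_const -mulr_natr -/s -/k.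
  by ring.
have [k0 _|] := eqVneq #|I| 0%N.
  have -> : s = 0 by apply: big1 => i _; have /card0_eq /(_ i) := k0.
  by rewrite /k k0 mul0r expr0n.
by rewrite -lt0n => k0; rewrite pmulr_rge0 ?ltr0n // subr_ge0.
Qed.

Section CompleteBipartite.
Variables (R : rcfType) (P Q : finType).

Definition distK (u v : P + Q) : R :=
  match u, v with
  | inl i, inl j => 2 * (i != j)%:R
  | inr i, inr j => 2 * (i != j)%:R
  | _, _ => 1
  end.

Definition sides (a : P -> R) (b : Q -> R) (u : P + Q) : R :=
  match u with inl i => a i | inr j => b j end.

Local Notation p := (#|P|%:R : R).
Local Notation q := (#|Q|%:R : R).
Local Notation n := (p + q).

Lemma sum_sides (F : P + Q -> R) :
  \sum_u F u = \sum_i F (inl i) + \sum_j F (inr j).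
Proof. by rewrite big_sumType. Qed.

Lemma dot_sides a b a' b' :
  dot (sides a b) (sides a' b') = \sum_i a i * a' i + \sum_j b j * b' j.
Proof. by rewrite /dot sum_sides. Qed.

Lemma lapform_sides (D : P + Q -> P + Q -> R) a b : (forall u v, D u v = D v u) ->
  lapform D (sides a b) =
    2^-1 * (\sum_i \sum_i' D (inl i) (inl i') * (a i - a i') ^+ 2)
    + 2^-1 * (\sum_j \sum_j' D (inr j) (inr j') * (b j - b j') ^+ 2)
    + \sum_i \sum_j D (inl i) (inr j) * (a i - b j) ^+ 2.
Proof.
move=> symD; rewrite /lapform sum_sides /=.
under eq_bigr do rewrite sum_sides.
under [X in _ + X]eq_bigr do rewrite sum_sides.
rewrite !big_split /= [X in _ * (_ + (X + _))]exchange_big /=.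
under [X in _ * (_ + (X + _))]eq_bigr => i _.
  under eq_bigr => j _ do rewrite symD -opprB sqrrN.
  over.
by set x := \sum_i _; set y := \sum_i _; set w := \sum_i _; lra.
Qed.

Lemma sum_sqr_diff (I : finType) (a : I -> R) :
  \sum_i \sum_j (a i - a j) ^+ 2
  = 2 * (#|I|%:R * \sum_i a i ^+ 2 - (\sum_i a i) ^+ 2).
Proof.
under eq_bigr => i _.
  rewrite (eq_bigr (fun j => a i ^+ 2 - 2 * a i * a j + a j ^+ 2)) => [|j _];
    last by ring.
  rewrite big_split sumrB /= sum_constr -mulr_sumr.
  over.
rewrite big_split sumrB /= sum_constr -!mulr_suml -!mulr_sumr.
by ring.
Qed.

Lemma sum_sqr_cross (a : P -> R) (b : Q -> R) :
  \sum_i \sum_j (a i - b j) ^+ 2 = q * (\sum_i a i ^+ 2) + p * (\sum_j b j ^+ 2)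
    - 2 * (\sum_i a i) * (\sum_j b j).
Proof.
under eq_bigr => i _.
  rewrite (eq_bigr (fun j => a i ^+ 2 - 2 * a i * b j + b j ^+ 2)) => [|j _];
    last by ring.
  rewrite big_split sumrB /= sum_constr -mulr_sumr.
  over.
rewrite big_split sumrB /= sum_constr -!mulr_suml -!mulr_sumr.
by ring.
Qed.

Lemma lapform_distK a b :
  lapform distK (sides a b) = (2 * n - q) * (\sum_i a i ^+ 2)
    + (2 * n - p) * (\sum_j b j ^+ 2) + 2 * (\sum_i a i) * (\sum_j b j)
    - 2 * (\sum_i a i + \sum_j b j) ^+ 2.
Proof.
rewrite lapform_sides => [|[i|i] [j|j]] //=; try by rewrite eq_sym.
have within (I : finType) (c : I -> R) :
  \sum_i \sum_j 2 * (i != j)%:R * (c i - c j) ^+ 2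
  = 2 * \sum_i \sum_j (c i - c j) ^+ 2.
  rewrite mulr_sumr; apply: eq_bigr => i _; rewrite mulr_sumr; apply: eq_bigr => j _.
  by have [->|_] := eqVneq i j; rewrite ?subrr ?expr0n ?mulr0 ?mulr1.
rewrite !within !sum_sqr_diff.
under [X in _ + _ + X]eq_bigr do under eq_bigr do rewrite mul1r.
by rewrite sum_sqr_cross; lra.
Qed.

Lemma sum_distK : \sum_u \sum_v distK u v = 2 * (n ^+ 2 - n - p * q).
Proof.
have within (I : finType) :
  \sum_(i : I) \sum_j 2 * (i != j)%:R = 2 * (#|I|%:R ^+ 2 - #|I|%:R) :> R.
  rewrite (eq_bigr (fun=> 2 * (#|I|%:R - 1))) => [|i _].
    by rewrite sum_constr; ring.
  rewrite -mulr_sumr (bigD1 i) //= eqxx add0r; congr (_ * _).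
  rewrite (eq_bigr (fun=> 1)) => [|j]; last by rewrite eq_sym => ->.
  rewrite sumr_const cardC1 -subn1 natrB //.
  by rewrite (cardD1 i) inE add1n.
have cross (I J : finType) : \sum_(i : I) \sum_(j : J) 1 = #|I|%:R * #|J|%:R :> R.
  by rewrite !sum_constr mulr1.
rewrite sum_sides /=.
under eq_bigr do rewrite sum_sides /=.
under [X in _ + X]eq_bigr do rewrite sum_sides /=.
by rewrite !big_split /= !within !cross; ring.
Qed.

End CompleteBipartite.

(** * Transport of the forms along a bijection *)

Section FormsExt.
Variables (R : rcfType) (T U : finType).

Lemma eq_lapform (D D' : T -> T -> R) z :
  (forall u v, D u v = D' u v) -> lapform D z = lapform D' z.
Proof.
move=> eqD; congr (_ * _); apply: eq_bigr => u _; apply: eq_bigr => v _.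
by rewrite eqD.
Qed.

Lemma eq_mean_trans (D D' : T -> T -> R) :
  (forall u v, D u v = D' u v) -> mean_trans D = mean_trans D'.
Proof.
by move=> eqD; congr (_ / _); apply: eq_bigr => u _; apply: eq_bigr => v _.
Qed.

Variable h : U -> T.
Hypothesis bij_h : bijective h.

Lemma reindex_bij (F : T -> R) : \sum_u F u = \sum_x F (h x).
Proof. by rewrite (reindex h) //; apply: onW_bij. Qed.

Lemma lapform_bij (D : T -> T -> R) z :
  lapform D z = lapform (fun x y => D (h x) (h y)) (z \o h).
Proof.
congr (_ * _); rewrite reindex_bij; apply: eq_bigr => x _.
by rewrite reindex_bij.
Qed.

Lemma mean_trans_bij (D : T -> T -> R) :
  mean_trans D = mean_trans (fun x y => D (h x) (h y)).
Proof.
rewrite /mean_trans (bij_eq_card bij_h) reindex_bij; congr (_ / _).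
by apply: eq_bigr => x _; rewrite reindex_bij.
Qed.

End FormsExt.

(** Used with [U] the disjoint sum of the two sides of [G], so that sums over vertices split into
    sums over each side. *)
Lemma DLE_lower_bij (R : rcfType) (G : sgraph) (U : finType) (h : U -> G)
    (D : U -> U -> R) (z y : U -> R) :
  bijective h -> (forall u v, (gdist (h u) (h v))%:R = D u v) -> (0 < #|U|)%N ->
  \sum_u z u = 0 -> \sum_u y u = 0 -> dot z y = 0 ->
  2 * mean_trans D - 2 * ((lapform D z - mean_trans D * dot z z) / dot z z)
    - 2 * ((lapform D y - mean_trans D * dot y y) / dot y y) <= DLE R G.
Proof.
move=> bij_h hD U0 z1 y1 zy; have [g hg gh] := bij_h.
have zh (x : U -> R) u : ((x \o g) \o h) u = x u by rewrite /= hg.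
have dotE x x' : dot (x \o g) (x' \o g) = dot x x' :> R.
  by rewrite /dot (reindex_bij bij_h); apply: eq_bigr => u _; rewrite /= !hg.
have lapE x : lapform (fun u v : G => (gdist u v)%:R) (x \o g) = lapform D x :> R.
  rewrite (lapform_bij bij_h) (eq_lapform _ hD) /lapform; congr (_ * _).
  by apply: eq_bigr => u _; apply: eq_bigr => v _; rewrite /= !hg.
have sumE (x : U -> R) : \sum_v (x \o g) v = \sum_u x u.
  by rewrite (reindex_bij bij_h); apply: eq_bigr => u _; rewrite /= hg.
have tE : mean_trans (fun u v : G => (gdist u v)%:R) = mean_trans D :> R.
  by rewrite (mean_trans_bij bij_h); apply: eq_mean_trans.
have := @DLE_lower R G (z \o g) (y \o g).
rewrite !sumE !dotE !lapE tE; apply => //.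
by rewrite -(bij_eq_card bij_h).
Qed.

Section Kab.
Variables (a b : nat).
Hypotheses (a_gt0 : (0 < a)%N) (b_gt0 : (0 < b)%N).

Lemma order_Kab : order_of (Kab a b) = (a + b)%N.
Proof. by rewrite /order_of card_sum !card_ord. Qed.

Lemma connected_Kab : connected (Kab a b).
Proof.
pose i0 := Ordinal a_gt0; pose j0 := Ordinal b_gt0.
have c1 (i : 'I_a) (j : 'I_b) : connect (@sedge (Kab a b)) (inl i) (inr j).
  exact: connect1.
have c2 (i : 'I_a) (j : 'I_b) : connect (@sedge (Kab a b)) (inr j) (inl i).
  exact: connect1.
move=> [i|i] [j|j] //; first exact: connect_trans (c1 i j0) (c2 j j0).
exact: connect_trans (c2 i0 i) (c1 i0 j).
Qed.

Lemma bipartite_Kab : bipartite (Kab a b).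
Proof.
by exists [set u : Kab a b | if u is inl _ then true else false] => [[i|i] [j|j]];
  rewrite !inE.
Qed.

Lemma gdist_Kab (R : rcfType) (u v : Kab a b) : (gdist u v)%:R = distK R u v.
Proof.
pose i0 := Ordinal a_gt0; pose j0 := Ordinal b_gt0.
have [A bipA] := bipartite_Kab.
have edge1 (x y : Kab a b) : sedge x y -> gdist x y = 1%N.
  move=> xy; apply/eqP; rewrite eqn_leq gdist_edge //=.
  apply: gdist_gt0 => //; first exact: connected_Kab.
  by apply: contraTneq xy => ->; rewrite sedge_irrefl.
have two (x y w : Kab a b) : sedge x w -> sedge w y -> x != y -> gdist x y = 2%N.
  move=> xw wy xy; have := gdist_gt0 connected_Kab xy.
  have := gdist_step y connected_Kab xw; rewrite (edge1 w) //.
  have : odd (gdist x y) = false.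
    rewrite (odd_gdist bipA) //; last exact: connected_Kab.
    have := bipA _ _ xw; have := bipA _ _ wy.
    by case: (x \in A); case: (w \in A); case: (y \in A).
  by case: (gdist x y) => [|[|[|k]]].
case: u v => [i|i] [j|j]; rewrite /distK; try by rewrite edge1.
  have [->|ij] := eqVneq i j; first by rewrite gdist_refl mulr0.
  by rewrite (@two _ _ (inr j0)) // mulr1.
have [->|ij] := eqVneq i j; first by rewrite gdist_refl mulr0.
by rewrite (@two _ _ (inl i0)) // mulr1.
Qed.

(** The spectrum is [0] on the constants, [n] on [(b, - a)], and [2 n - b], [2 n - a] on the vectors
    of zero sum supported by one side. Near balance puts the last two above [t], so only the first
    two can lie below it, by [t] and [t - n]; [c] dominates the positive part of the latter. *)
Lemma DLE_Kab_upper (R : rcfType) (c : R) : (a <= b <= a.+1)%N -> 0 <= c ->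
  let n : R := (a + b)%:R in
  let t : R := 2 * n - 2 - 2 * a%:R * b%:R / n in
  t - n <= c -> DLE R (Kab a b) <= 2 * (t + c).
Proof.
move=> /andP[ab ba] c0 n t tc.
pose p : R := a%:R; pose q : R := b%:R.
have p1 : 1 <= p by rewrite ler1n.
have q1 : 1 <= q by rewrite ler1n.
have pq : p <= q by rewrite ler_nat.
have qp : q <= p + 1 by rewrite /q /p natr1 ler_nat.
have nE : n = p + q by rewrite /n natrD.
have n0 : n != 0 by rewrite nE; lra.
have p0 : p != 0 by lra.
have q0 : q != 0 by lra.
have tE : mean_trans (distK R (P := 'I_a) (Q := 'I_b)) = t.
  rewrite /mean_trans sum_distK card_sum !card_ord -/p -/q -/n -nE /t -/p -/q.
  by field; rewrite -natrD.
pose r : R := p * q / n.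
have rn : r * n = p * q by rewrite mulfVK.
have tr : t = 2 * n - 2 - 2 * r by rewrite /t /r -/p -/q; field; rewrite -natrD.
have n_gt0 : 0 < n by rewrite nE; lra.
(* With [q <= p + 1] this gives [t <= 2 n - q] and [t <= 2 n - p]. *)
have r_ge : p <= 2 * r.
  by rewrite -(ler_pM2r n_gt0) -mulrA rn nE; nra.
have r_le : 4 * r <= n.
  rewrite -(ler_pM2r n_gt0) -mulrA rn nE.
  by have := sqr_ge0 (p - q); nra.
have t0 : 0 <= t by rewrite tr nE in r_le *; lra.
pose w1 (_ : Kab a b) : R := 1.
pose w2 : Kab a b -> R := sides (fun=> q) (fun=> - p).
have w11 : dot w1 w1 = n.
  rewrite /dot (eq_bigr (fun=> 1)) => [|u _]; last by rewrite mulr1.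
  by rewrite sum_constr mulr1; congr (_%:R); apply: order_Kab.
have w22 : dot w2 w2 = n * p * q.
  by rewrite dot_sides !sum_constr !card_ord -/p -/q nE; ring.
have npq : 0 < n * p * q by rewrite !mulr_gt0 //; lra.
have -> : 2 * (t + c) = 2 * (t / n * dot w1 w1 + c / (n * p * q) * dot w2 w2).
  by rewrite w11 w22 !divfK // gt_eqF.
apply: DLE_upper => [||f]; [exact/divr_ge0/ltW | exact/divr_ge0/ltW |].
rewrite (eq_lapform f (@gdist_Kab R)) (eq_mean_trans (@gdist_Kab R)) tE.
pose g (i : 'I_a) := f (inl i); pose h (j : 'I_b) := f (inr j).
have -> : lapform (distK R (P := 'I_a) (Q := 'I_b)) f
    = lapform (distK R (P := 'I_a) (Q := 'I_b)) (sides g h).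
  by congr (_ * _); apply: eq_bigr => -[i|i] _; apply: eq_bigr => -[j|j].
rewrite lapform_distK !card_ord -/p -/q -nE.
have -> : dot f f = \sum_i g i ^+ 2 + \sum_j h j ^+ 2.
  by rewrite /dot sum_sides; congr (_ + _); apply: eq_bigr => ? _; rewrite expr2.
have -> : dot f w1 = \sum_i g i + \sum_j h j.
  by rewrite /dot sum_sides; congr (_ + _); apply: eq_bigr => ? _; rewrite mulr1.
have -> : dot f w2 = q * (\sum_i g i) - p * \sum_j h j.
  rewrite /dot sum_sides /= -!mulr_suml mulrC; congr (_ + _).
  by rewrite mulrC mulNr.
have := sqr_sum_le g; have := sqr_sum_le h; rewrite !card_ord -/p -/q.
set x := \sum_i g i; set y := \sum_j h j.
set X := \sum_i g i ^+ 2; set Y := \sum_j h j ^+ 2 => hY hX.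
(* Spectral decomposition: the Cauchy-Schwarz defects of the two sides and the square along
   [(q, - p)]; the weight [t / n] has cancelled the constants. *)
have -> : (2 * n - q) * X + (2 * n - p) * Y + 2 * x * y - 2 * (x + y) ^+ 2
    - t * (X + Y) + t / n * (x + y) ^+ 2 + c / (n * p * q) * (q * x - p * y) ^+ 2
  = (2 * n - q - t) / p * (p * X - x ^+ 2) + (2 * n - p - t) / q * (q * Y - y ^+ 2)
    + (c - (t - n)) / (n * p * q) * (q * x - p * y) ^+ 2.
  rewrite /t -/p -/q nE; field; rewrite -nE; lra.
rewrite !addr_ge0 // mulr_ge0 ?sqr_ge0 ?subr_ge0 // divr_ge0 ?(ltW npq) //; lra.
Qed.
End Kab.

(** * Signed complete bipartite graphs *)

(** Expanding one factor [A] in its eigenframe turns the form of the entrywise square into a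
    combination, with coefficients [lam k], of values of the form of [A] at the products
    [J * F k]. *)
Lemma Schur_square_psd (R : rcfType) (T : finType) (A : T -> T -> R) (J : T -> R) :
  (forall u v, A u v = A v u) ->
  (forall z, 0 <= \sum_u \sum_v A u v * z u * z v) ->
  0 <= \sum_u \sum_v A u v ^+ 2 * J u * J v.
Proof.
move=> symA posA.
pose M : 'M[R]_#|T| := \matrix_(i, j) A (enum_val i) (enum_val j).
have symM : M^T = M by apply/matrixP => i j; rewrite !mxE symA.
have [lam [f [_ eigM ONf _]]] := symmetric_eigenframe symM.
pose F k (x : T) := f k (enum_rank x).
have reindexT (h : 'I_#|T| -> R) : \sum_i h i = \sum_(x : T) h (enum_rank x).
  by rewrite (reindex _ (onW_bij _ (enum_rank_bij T))).
have eigF k x : \sum_y A x y * F k y = lam k.1 * F k x.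
  rewrite -eigM reindexT; apply: eq_bigr => y _.
  by rewrite mxE !enum_rankK.
have ONF x y : \sum_k F k x * F k y = (x == y)%:R.
  by rewrite ONf (inj_eq enum_rank_inj).
have AE x y : A x y = \sum_k lam k.1 * (F k x * F k y).
  symmetry; rewrite (eq_bigr (fun k => \sum_w A x w * (F k w * F k y))); last first.
    move=> k _; rewrite mulrA -eigF mulr_suml.
    by apply: eq_bigr => w _; rewrite mulrA.
  rewrite exchange_big /= (bigD1 y) //= -mulr_sumr ONF eqxx mulr1.
  rewrite big1 ?addr0 // => w wy.
  by rewrite -mulr_sumr ONF (negPf wy) mulr0.
have -> : \sum_u \sum_v A u v ^+ 2 * J u * J v =
    \sum_k lam k.1 * \sum_u \sum_v A u v * (J u * F k u) * (J v * F k v).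
  under [RHS]eq_bigr do rewrite mulr_sumr.
  rewrite [RHS]exchange_big; apply: eq_bigr => u _ /=.
  under [RHS]eq_bigr do rewrite mulr_sumr.
  rewrite [RHS]exchange_big; apply: eq_bigr => v _ /=.
  rewrite expr2 {1}AE !mulr_suml; apply: eq_bigr => k _.
  by ring.
apply: sumr_ge0 => k _.
have [lam_ge0|lam_lt0] := leP 0 (lam k.1); first by rewrite mulr_ge0.
(* Positivity at [F k] says [lam k * |F k|^2 >= 0], so a negative [lam k] can only go with a null
   frame vector. *)
suff F0 x : F k x = 0.
  rewrite big1 ?mulr0 // => u _; rewrite big1 // => v _.
  by rewrite !F0 !mulr0.
apply: dot_eq0; apply/eqP; rewrite eq_le dot_ge0 andbT.
rewrite -(nmulr_rge0 _ lam_lt0); apply: le_trans (posA (F k)) _.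
rewrite le_eqVlt; apply/orP; left; apply/eqP.
rewrite /dot mulr_sumr; apply: eq_bigr => w _.
rewrite mulrA -eigF mulr_suml; apply: eq_bigr => y _.
by ring.
Qed.

(** The arithmetic of [total_large], with [K = p q], [tau = - sigma] and [S2] the sum of all squared
    degrees. If [2 tau <= n - 1], then [1 + 4 tau - n <= 2 tau], and [4 K <= n^2] with
    [4 tau^2 <= n S2] make the expression nonpositive. *)
Lemma total_large_aux (R : realFieldType) (K n tau S2 : R) : 0 < K -> 0 < n ->
  4 * K <= n ^+ 2 -> 0 <= tau -> tau ^+ 2 * n <= S2 * K ->
  0 < - n * tau - S2 - 2 * (1 - (1 + 4 * tau) / n) * (K + tau) ->
  n - 1 < 2 * tau.
Proof.
move=> K0 n0 Kn t0 S2K; set E := (X in 0 < X).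
have -> : E = (- n ^+ 2 * tau - n * S2 + 2 * (1 + 4 * tau - n) * (K + tau)) / n.
  by rewrite /E; field; rewrite gt_eqF.
rewrite pmulr_lgt0 ?invr_gt0 // => {E} E0; rewrite ltNge; apply/negP => tn.
have nS : 4 * tau ^+ 2 <= n * S2.
  rewrite -(ler_pM2r K0); have := ler_wpM2l (ltW n0) S2K.
  by have := ler_wpM2l (sqr_ge0 tau) Kn; lra.
have Kt : 0 <= K + tau by lra.
have [x0|x0] := leP (1 + 4 * tau - n) 0.
  have := mulr_ge0_le0 Kt x0; have := mulr_ge0 (sqr_ge0 n) t0; have := sqr_ge0 tau.
  lra.
have xt : 1 + 4 * tau - n <= 2 * tau by lra.
have := ler_wpM2r Kt xt; have := ler_wpM2l t0 Kn; lra.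
Qed.

Section Signed.
Variables (R : rcfType) (P Q : finType) (eps : P -> Q -> R).
Hypothesis sgn_eps : forall i j, eps i j ^+ 2 = 1.

Definition rowsum i := \sum_j eps i j.
Definition colsum j := \sum_i eps i j.
Definition signsum := \sum_i rowsum i.
Definition signform (a : P -> R) (b : Q -> R) :=
  \sum_i \sum_j eps i j * (a i - b j) ^+ 2.

Local Notation p := (#|P|%:R : R).
Local Notation q := (#|Q|%:R : R).
Local Notation n := (p + q).
Local Notation r := rowsum.
Local Notation c := colsum.
Local Notation sigma := signsum.

Hypotheses (p_gt0 : 0 < p) (q_gt0 : 0 < q).

Lemma total_colsum : sigma = \sum_j c j.
Proof. by rewrite /signsum exchange_big. Qed.

(** By [sum_dev_sqr], the total squared deviation of the row sums from their mean [sigma / p]. *)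
Definition Vrow := \sum_i r i ^+ 2 - sigma ^+ 2 / p.
Definition Vcol := \sum_j c j ^+ 2 - sigma ^+ 2 / q.

Lemma sum_dev_sqr (I : finType) (x : I -> R) (s : R) : 0 < #|I|%:R :> R ->
  s = \sum_i x i ->
  \sum_i (x i - s / #|I|%:R) ^+ 2 = \sum_i x i ^+ 2 - s ^+ 2 / #|I|%:R.
Proof.
move=> I0 sE; rewrite (eq_bigr (fun i => x i ^+ 2 - 2 * (s / #|I|%:R) * x i
  + (s / #|I|%:R) ^+ 2)) => [|i _]; last by ring.
by rewrite big_split sumrB /= sum_constr -mulr_sumr -sE; field; rewrite gt_eqF.
Qed.

Lemma sum_dev (I : finType) (x : I -> R) (s : R) : 0 < #|I|%:R :> R ->
  s = \sum_i x i -> \sum_i (x i - s / #|I|%:R) = 0.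
Proof.
by move=> I0 sE; rewrite sumrB sum_constr -sE; field; rewrite gt_eqF.
Qed.

Lemma Vrow_ge0 : 0 <= Vrow.
Proof.
by rewrite /Vrow -sum_dev_sqr //; apply: sumr_ge0 => i _; exact: sqr_ge0.
Qed.

Lemma Vcol_ge0 : 0 <= Vcol.
Proof.
by rewrite /Vcol -(sum_dev_sqr _ total_colsum) //; apply: sumr_ge0 => i _; exact: sqr_ge0.
Qed.

Lemma sum_eps_row (x : P -> R) : \sum_i \sum_j eps i j * x i = \sum_i r i * x i.
Proof. by apply: eq_bigr => i _; rewrite mulr_suml. Qed.

Lemma sum_eps_col (y : Q -> R) : \sum_i \sum_j eps i j * y j = \sum_j c j * y j.
Proof. by rewrite exchange_big; apply: eq_bigr => j _; rewrite mulr_suml. Qed.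

Lemma signformE a b : signform a b = \sum_i r i * a i ^+ 2 + \sum_j c j * b j ^+ 2
  - 2 * \sum_i \sum_j eps i j * a i * b j.
Proof.
rewrite -sum_eps_row -sum_eps_col -big_split mulr_sumr -sumrB /=.
apply: eq_bigr => i _; rewrite mulr_sumr -big_split -sumrB /=.
by apply: eq_bigr => j _; ring.
Qed.

(** For mean eigenvalue [2 (n - 1) + 2 sigma / n], an energy below [4 n - 8 + 2 / n] forces the
    quotient of [signform] on the orthogonal of the constants to exceed exactly [- theta]. *)
Definition theta := (1 - 4 * sigma) / n.
Hypothesis form_gt : forall a b, \sum_i a i + \sum_j b j = 0 ->
  0 < \sum_i a i ^+ 2 + \sum_j b j ^+ 2 ->
  - theta * (\sum_i a i ^+ 2 + \sum_j b j ^+ 2) < signform a b.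
Hypothesis total_le0 : sigma <= 0.

Let n_gt0 : 0 < n. Proof. exact: addr_gt0. Qed.

(** Test with [q] on one side and [- p] on the other: every difference across is [n]. *)
Lemma total_imbalance : - sigma * (n ^+ 2 - 4 * (p * q)) < p * q.
Proof.
have := @form_gt (fun=> q) (fun=> - p); rewrite !sum_constr.
have -> : signform (fun=> q) (fun=> - p) = n ^+ 2 * sigma.
  rewrite /signform; under eq_bigr do rewrite -mulr_suml.
  by rewrite -mulr_suml -/(signsum); ring.
have -> : p * q + q * - p = 0 by ring.
have -> : p * q ^+ 2 + q * (- p) ^+ 2 = n * (p * q) by ring.
move=> /(_ erefl (mulr_gt0 n_gt0 (mulr_gt0 p_gt0 q_gt0))).
have -> : - theta * (n * (p * q)) = - (1 - 4 * sigma) * (p * q).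
  by rewrite /theta; field; rewrite gt_eqF.
lra.
Qed.

(** Test with the difference of two unit vectors; its squared norm is [2], and the cross term gives
    [2 * eps i0 j0 = -2]. *)
Lemma edge_form i0 j0 : eps i0 j0 = -1 -> 0 < r i0 + c j0 - 2 + 2 * theta.
Proof.
move=> e0.
have S1 (I : finType) (k : I) (F : I -> R) : \sum_i F i * (i == k)%:R = F k.
  rewrite (bigD1 k) //= eqxx mulr1 big1 ?addr0 // => i /negPf->.
  by rewrite mulr0.
have d2 (I : finType) (k i : I) : (i == k)%:R ^+ 2 = (i == k)%:R :> R.
  by case: eqP; rewrite ?expr1n ?expr0n.
have S0 (I : finType) (k : I) : \sum_i (i == k)%:R = 1 :> R.
  by rewrite -[RHS](S1 _ k (fun=> 1)); apply: eq_bigr => i _; rewrite mul1r.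
have := @form_gt (fun i => (i == i0)%:R) (fun j => - (j == j0)%:R).
rewrite signformE sumrN !S0 subrr.
under [X in _ + X]eq_bigr do rewrite sqrrN d2.
under [X in X + _]eq_bigr do rewrite d2.
rewrite !S0 => /(_ erefl).
under [X in _ < X + _ - _]eq_bigr do rewrite d2.
under [X in _ < _ + X - _]eq_bigr do rewrite sqrrN d2.
rewrite !S1.
under [X in _ < _ + _ - _ * X]eq_bigr => i _.
  under eq_bigr do rewrite mulrN.
  rewrite sumrN S1 -mulNr.
  over.
rewrite S1 e0 => h; have h2 : (0 : R) < 1 + 1 by rewrite addr_gt0 ?ltr01.
by move: (h h2); lra.
Qed.

Lemma total_large : n - 1 < - 2 * sigma.
Proof.
have pq_gt0 : 0 < p * q by rewrite mulr_gt0.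
(* The weight [1 - eps] is [0] or [2], so the sum of [F] collects [edge_form] over the pairs of sign
   [-1] and is a polynomial in the degrees. *)
pose F i j := (1 - eps i j) * (r i + c j - 2 + 2 * theta).
have F_ge0 i j : 0 <= F i j.
  have : eps i j = 1 \/ eps i j = -1.
    by have /eqP := sgn_eps i j; rewrite sqrf_eq1 => /orP[] /eqP; [left|right].
  rewrite /F; case=> e; first by rewrite e subrr mul0r.
  by have := edge_form e; rewrite e; lra.
have sumF : \sum_i \sum_j F i j = n * sigma - (\sum_i r i ^+ 2 + \sum_j c j ^+ 2)
    - 2 * (1 - theta) * (p * q - sigma).
  have -> : \sum_i \sum_j F i j = q * sigma - \sum_i r i ^+ 2 + p * sigma - \sum_j c j ^+ 2
    - 2 * (1 - theta) * (p * q - sigma); last by ring.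
  have [k kE] : exists k, k = 2 * (1 - theta) by exists (2 * (1 - theta)).
  rewrite (eq_bigr (fun i => \sum_(j : Q) r i + \sum_j c j - \sum_j eps i j * r i
      - \sum_j eps i j * c j - \sum_(j : Q) k + k * r i)) => [|i _]; last first.
    rewrite (eq_bigr (fun j => r i + c j - eps i j * r i - eps i j * c j - k
      + k * eps i j)) => [|j _]; last by rewrite kE /F; ring.
    by rewrite big_split !sumrB big_split /= -mulr_sumr.
  rewrite big_split !sumrB big_split /= -mulr_sumr sum_eps_row sum_eps_col.
  under eq_bigr do rewrite sum_constr.
  rewrite -mulr_sumr !sum_constr -total_colsum -/signsum -kE.
  under [X in _ - X - _ - _]eq_bigr do rewrite -expr2.
  under [X in _ - _ - X - _]eq_bigr do rewrite -expr2.
  by ring.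
(* A zero sum would leave no pair of sign [-1], making [sigma = p q] positive. *)
have sum_gt0 : 0 < \sum_i \sum_j F i j.
  rewrite lt_neqAle eq_sym sumr_ge0 ?andbT => [|i _]; last exact: sumr_ge0.
  apply/negP; rewrite psumr_eq0 => [|i _]; last exact: sumr_ge0.
  move=> /allP F0.
  have e1 i j : eps i j = 1.
    have := F0 i (mem_index_enum i); rewrite psumr_eq0 // => /allP /(_ j (mem_index_enum j)).
    have /eqP := sgn_eps i j; rewrite sqrf_eq1 => /orP[] /eqP // e.
    by have := edge_form e; rewrite /F e => h /eqP; lra.
  have : sigma = p * q.
    rewrite /signsum /rowsum; under eq_bigr do under eq_bigr do rewrite e1.
    by rewrite !sum_constr mulr1.
  by move: total_le0 => + sE; rewrite sE; lra.
have S2_ge : sigma ^+ 2 * n <= (\sum_i r i ^+ 2 + \sum_j c j ^+ 2) * (p * q).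
  have := Vrow_ge0; have := Vcol_ge0; rewrite /Vrow /Vcol.
  rewrite !subr_ge0 !ler_pdivrMr // => hc hr.
  have := ler_wpM2l (ltW q_gt0) hr; have := ler_wpM2l (ltW p_gt0) hc; lra.
rewrite sumF in sum_gt0.
have -> : - 2 * sigma = 2 * - sigma by ring.
apply: (@total_large_aux _ (p * q) n _ (\sum_i r i ^+ 2 + \sum_j c j ^+ 2));
  rewrite ?oppr_ge0 //.
- by have := sqr_ge0 (p - q); lra.
- by rewrite sqrrN.
- by move: sum_gt0; rewrite /theta; lra.
Qed.

Lemma theta_gt0 : 0 < theta.
Proof. by rewrite /theta divr_gt0 //; move: total_le0; lra. Qed.

(* The test vector is the first Newton correction of [(q, - p)] towards a
   minimiser of the form on the orthogonal of the constants. *)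
Lemma dev_bound : n ^+ 2 * (Vrow + Vcol)
  < (p * q + sigma * (n ^+ 2 - 4 * (p * q))) * (n + theta).
Proof.
have nt_gt0 : 0 < n + theta by rewrite addr_gt0 ?theta_gt0.
(* This step length minimises [- 2 n l V + (n + theta) l^2 V], the effect of the correction once
   [W <= n V] is used. *)
set V := Vrow + Vcol; pose l := n / (n + theta).
have lE : l * (n + theta) = n by rewrite divfK ?gt_eqF.
pose x i := r i - sigma / p; pose y j := c j - sigma / q.
have sx : \sum_i x i = 0 by apply: sum_dev.
have sy : \sum_j y j = 0 by apply: sum_dev => //; apply: total_colsum.
have sxx : \sum_i x i ^+ 2 = Vrow by rewrite sum_dev_sqr.
have syy : \sum_j y j ^+ 2 = Vcol by rewrite (sum_dev_sqr _ total_colsum).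
have srx : \sum_i r i * x i = Vrow.
  rewrite (eq_bigr (fun i => r i ^+ 2 - sigma / p * r i)) => [|i _]; last by rewrite /x; ring.
  by rewrite sumrB -mulr_sumr -/signsum /Vrow; congr (_ - _); ring.
have scy : \sum_j c j * y j = Vcol.
  rewrite (eq_bigr (fun j => c j ^+ 2 - sigma / q * c j)) => [|j _]; last by rewrite /y; ring.
  by rewrite sumrB -mulr_sumr -total_colsum /Vcol; congr (_ - _); ring.
pose W := \sum_i \sum_j eps i j * (x i + y j) ^+ 2.
have W_le : W <= n * V.
  apply: (@le_trans _ _ (\sum_i \sum_j (x i - - y j) ^+ 2)).
    apply: ler_sum => i _; apply: ler_sum => j _; rewrite opprK.
    rewrite -[X in _ <= X]mul1r ler_wpM2r ?sqr_ge0 //.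
    by have := sgn_eps i j; have := sqr_ge0 (eps i j - 1); lra.
  rewrite sum_sqr_cross sumrN sx sy; under [X in _ + _ * X]eq_bigr do rewrite sqrrN.
  rewrite sxx syy /V; have := mulr_ge0 (ltW p_gt0) Vrow_ge0.
  by have := mulr_ge0 (ltW q_gt0) Vcol_ge0; lra.
pose a i := q - l * x i; pose b j := - p + l * y j.
have sa : \sum_i a i = p * q by rewrite sumrB sum_constr -mulr_sumr sx; ring.
have sb : \sum_j b j = - (p * q).
  by rewrite big_split /= sum_constr -mulr_sumr sy; ring.
have saa : \sum_i a i ^+ 2 = p * q ^+ 2 + l ^+ 2 * Vrow.
  rewrite (eq_bigr (fun i => q ^+ 2 - 2 * q * l * x i + l ^+ 2 * x i ^+ 2)) => [|i _];
    last by rewrite /a; ring.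
  by rewrite big_split sumrB /= sum_constr -!mulr_sumr sx sxx; ring.
have sbb : \sum_j b j ^+ 2 = q * p ^+ 2 + l ^+ 2 * Vcol.
  rewrite (eq_bigr (fun j => p ^+ 2 - 2 * p * l * y j + l ^+ 2 * y j ^+ 2)) => [|j _];
    last by rewrite /b; ring.
  by rewrite big_split sumrB /= sum_constr -!mulr_sumr sy syy; ring.
have formE : signform a b = n ^+ 2 * sigma - 2 * n * l * V + l ^+ 2 * W.
  rewrite /signform (eq_bigr (fun i => \sum_j n ^+ 2 * eps i j
      - \sum_j 2 * n * l * (eps i j * x i) - \sum_j 2 * n * l * (eps i j * y j)
      + \sum_j l ^+ 2 * (eps i j * (x i + y j) ^+ 2))) => [|i _]; last first.
    rewrite -!sumrB -big_split /=; apply: eq_bigr => j _.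
    by rewrite /a /b; ring.
  rewrite big_split !sumrB /=.
  have pull k (F : P -> Q -> R) :
    \sum_i \sum_j k * F i j = k * \sum_i \sum_j F i j.
    by rewrite mulr_sumr; apply: eq_bigr => i _; rewrite mulr_sumr.
  rewrite (pull _ (fun i j => eps i j * x i)) (pull _ (fun i j => eps i j * y j)).
  rewrite (pull _ (fun i j => eps i j * (x i + y j) ^+ 2)) (pull _ eps).
  rewrite sum_eps_row sum_eps_col srx scy -/signsum -/W /V.
  by ring.
have V_ge0 : 0 <= V by rewrite addr_ge0 ?Vrow_ge0 ?Vcol_ge0.
have := @form_gt a b; rewrite sa sb subrr saa sbb formE => /(_ erefl).
have -> : p * q ^+ 2 + l ^+ 2 * Vrow + (q * p ^+ 2 + l ^+ 2 * Vcol)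
  = n * (p * q) + l ^+ 2 * V by rewrite /V; ring.
have npq : 0 < n * (p * q) by rewrite !mulr_gt0.
have l2V : 0 <= l ^+ 2 * V by rewrite mulr_ge0 ?sqr_ge0.
move=> /(_ (ltr_wpDr l2V npq)) h.
have h2 := ler_wpM2l (sqr_ge0 l) W_le.
have llV : l ^+ 2 * (n + theta) * V = n * l * V.
  have -> : l ^+ 2 * (n + theta) * V = l * (l * (n + theta)) * V by ring.
  by rewrite lE; ring.
have tE : theta * n = 1 - 4 * sigma by rewrite divfK ?gt_eqF.
have nl : n * l * V < p * q + sigma * (n ^+ 2 - 4 * (p * q)).
  have : theta * (n * (p * q)) = (1 - 4 * sigma) * (p * q) by rewrite -tE; ring.
  lra.
have := nl; rewrite -(ltr_pM2r nt_gt0).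
have -> : n * l * V * (n + theta) = n * (l * (n + theta)) * V by ring.
by rewrite lE -expr2.
Qed.

End Signed.

(** * The trace inequality for the centred sign matrix *)

Lemma sum_quadratic (R : comPzRingType) (I : finType) (x : I -> R) (k0 k1 k2 : R) :
  \sum_i (k0 + k1 * x i + k2 * x i ^+ 2)
  = #|I|%:R * k0 + k1 * (\sum_i x i) + k2 * \sum_i x i ^+ 2.
Proof. by rewrite !big_split /= sum_constr -!mulr_sumr. Qed.

Lemma sum_diagonal (R : pzRingType) (I : finType) (F : I -> I -> R) :
  \sum_i \sum_j (i == j)%:R * F i j = \sum_i F i i.
Proof.
apply: eq_bigr => i _; rewrite (bigD1 i) //= eqxx mul1r big1 ?addr0 // => j.
by rewrite eq_sym => /negPf->; rewrite mul0r.
Qed.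

(* [C *m diag x *m C] with [C] the projection on the vectors of zero sum *)
Definition centred_diag (R : fieldType) (I : finType) (x : I -> R) (i j : I) : R :=
  (i == j)%:R * x i - (x i + x j) / #|I|%:R + (\sum_k x k) / #|I|%:R ^+ 2.

Section CentredDiag.
Variables (R : realFieldType) (I : finType) (x : I -> R).
Hypothesis card_gt0 : 0 < #|I|%:R :> R.
Local Notation k := (#|I|%:R : R).

Lemma centred_diag_form (a : I -> R) :
  \sum_i \sum_j centred_diag x i j * a i * a j
  = \sum_i x i * (a i - (\sum_j a j) / k) ^+ 2.
Proof.
set s := \sum_j a j; set S := \sum_j x j; set T := \sum_i x i * a i.
have sqE y : \sum_i x i * (a i - y) ^+ 2
    = \sum_i x i * a i ^+ 2 - 2 * y * T + y ^+ 2 * S.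
  rewrite /T /S !mulr_sumr -sumrB -big_split /=.
  by apply: eq_bigr => i _; ring.
rewrite sqE.
have -> : \sum_i x i * a i ^+ 2 = \sum_i \sum_j (i == j)%:R * (x i * a i * a j).
  by rewrite sum_diagonal; apply: eq_bigr => i _; rewrite expr2 mulrA.
have -> : \sum_i \sum_j centred_diag x i j * a i * a j
    = \sum_i (\sum_j (i == j)%:R * (x i * a i * a j) - x i * a i * (s / k)
              - a i * (T / k) + a i * (S / k ^+ 2 * s)).
  apply: eq_bigr => i _.
  rewrite (eq_bigr (fun j => (i == j)%:R * (x i * a i * a j) - (x i * a i / k) * a j
    - (a i / k) * (x j * a j) + (a i * (S / k ^+ 2)) * a j)) => [|j _].
    by rewrite big_split !sumrB /= -!mulr_sumr -/s -/T; ring.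
  by rewrite /centred_diag -/S; ring.
rewrite big_split !sumrB /= -!mulr_suml -/s -/T.
by field; rewrite gt_eqF.
Qed.

(** Projecting a matrix on both sides does not increase its Frobenius norm. Here the norm is
    computed exactly, and [S ^+ 2 <= k * X] finishes. *)
Lemma centred_diag_sqr :
  \sum_i \sum_j centred_diag x i j ^+ 2 <= \sum_i x i ^+ 2.
Proof.
set X := \sum_i x i ^+ 2; pose S := \sum_i x i.
have k0 : k != 0 by rewrite gt_eqF.
have -> : \sum_i \sum_j centred_diag x i j ^+ 2 = X - 2 * X / k + S ^+ 2 / k ^+ 2.
  pose G i j := x i ^+ 2 - 2 * x i * ((x i + x j) / k - S / k ^+ 2).
  have -> : \sum_i \sum_j centred_diag x i j ^+ 2 = \sum_i \sum_j (i == j)%:R * G i j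
      + \sum_i \sum_j ((x i + x j) / k - S / k ^+ 2) ^+ 2.
    rewrite -big_split; apply: eq_bigr => i _; rewrite -big_split; apply: eq_bigr => j _ /=.
    by rewrite /centred_diag /G -/S; case: (i == j); rewrite ?(mul0r, mul1r); ring.
  rewrite sum_diagonal.
  have -> : \sum_i G i i = X * (1 - 4 / k) + 2 * S * S / k ^+ 2.
    rewrite (eq_bigr (fun i => 0 + 2 * S / k ^+ 2 * x i + (1 - 4 / k) * x i ^+ 2)) => [|i _].
      by rewrite sum_quadratic -/S -/X; ring.
    by rewrite /G; field.
  have -> : \sum_i \sum_j ((x i + x j) / k - S / k ^+ 2) ^+ 2
      = 2 * X / k - S ^+ 2 / k ^+ 2.
    rewrite (eq_bigr (fun i => (X / k ^+ 2 - S ^+ 2 / k ^+ 3) + 0 * x i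
        + k^-1 * x i ^+ 2)) => [|i _].
      by rewrite sum_quadratic -/S -/X; field.
    rewrite (eq_bigr (fun j => (x i / k - S / k ^+ 2) ^+ 2
        + 2 * (x i / k - S / k ^+ 2) / k * x j + (k ^+ 2)^-1 * x j ^+ 2)) => [|j _].
      by rewrite sum_quadratic -/S -/X; field.
    by field.
  by field.
have SX := sqr_sum_le x; have X0 : 0 <= X by apply: sumr_ge0 => i _; exact: sqr_ge0.
rewrite -/S -/X in SX.
have : S ^+ 2 / k ^+ 2 <= X / k.
  rewrite ler_pdivrMr ?exprn_gt0 //.
  by have -> : X / k * k ^+ 2 = k * X by field.
by have := divr_ge0 X0 (ltW card_gt0); lra.
Qed.

End CentredDiag.

Section SignedTrace.
Variables (R : rcfType) (P Q : finType) (eps : P -> Q -> R).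
Hypothesis sgn_eps : forall i j, eps i j ^+ 2 = 1.
Local Notation p := (#|P|%:R : R).
Local Notation q := (#|Q|%:R : R).
Local Notation r := (rowsum eps).
Local Notation c := (colsum eps).
Local Notation sigma := (signsum eps).
Hypotheses (p_gt0 : 0 < p) (q_gt0 : 0 < q).

(** The matrix [eps] projected on both sides to the vectors of zero sum. *)
Definition centred i j := eps i j - r i / q - c j / p + sigma / (p * q).

Lemma sum_centred_sqr : \sum_i \sum_j centred i j ^+ 2
  = p * q - (\sum_i r i ^+ 2) / q - (\sum_j c j ^+ 2) / p + sigma ^+ 2 / (p * q).
Proof.
have p0 : p != 0 by rewrite gt_eqF.
have q0 : q != 0 by rewrite gt_eqF.
(* The constant is absorbed into [u], which then has zero sum, so the product of [u] and [w] drops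
   out of the expansion. *)
pose u i := sigma / (p * q) - r i / q; pose w j := - (c j / p).
have su : \sum_i u i = 0.
  by rewrite sumrB sum_constr -mulr_suml -/(signsum eps); field; rewrite ?p0 ?q0.
rewrite (eq_bigr (fun i => \sum_(j : Q) 1 + \sum_(j : Q) u i ^+ 2 + \sum_j w j ^+ 2
   + 2 * (\sum_j eps i j * u i) + 2 * (\sum_j eps i j * w j)
   + 2 * (u i * \sum_j w j))) => [|i _]; last first.
  rewrite !mulr_sumr -!big_split /=; apply: eq_bigr => j _.
  have -> : centred i j = eps i j + u i + w j by rewrite /centred /u /w; ring.
  have -> : (eps i j + u i + w j) ^+ 2 = eps i j ^+ 2 + (u i ^+ 2 + w j ^+ 2
    + 2 * (eps i j * u i) + 2 * (eps i j * w j) + 2 * (u i * w j)) by ring.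
  by rewrite sgn_eps; ring.
rewrite !big_split /= -!mulr_sumr (sum_eps_row eps) (sum_eps_col eps) -!mulr_suml su.
under [X in _ + X + _ + _ + _ + _]eq_bigr do rewrite sum_constr.
rewrite !sum_constr -mulr_sumr.
have -> : \sum_j w j ^+ 2 = (\sum_j c j ^+ 2) / p ^+ 2.
  by rewrite mulr_suml; apply: eq_bigr => j _; rewrite /w sqrrN expr_div_n.
have -> : \sum_j c j * w j = - (\sum_j c j ^+ 2) / p.
  by rewrite mulNr mulr_suml -sumrN; apply: eq_bigr => j _; rewrite /w; ring.
have -> : \sum_i r i * u i = sigma ^+ 2 / (p * q) - (\sum_i r i ^+ 2) / q.
  rewrite (eq_bigr (fun i => 0 + sigma / (p * q) * r i + (- q^-1) * r i ^+ 2)) => [|i _].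
    by rewrite sum_quadratic -/(signsum eps); field; rewrite ?p0 ?q0.
  by rewrite /u; field; rewrite ?p0 ?q0.
have -> : \sum_i u i ^+ 2 = (\sum_i r i ^+ 2) / q ^+ 2 - sigma ^+ 2 / (p * q ^+ 2).
  rewrite (eq_bigr (fun i => (sigma / (p * q)) ^+ 2 + (- 2 * sigma / (p * q ^+ 2)) * r i
     + (q ^+ 2)^-1 * r i ^+ 2)) => [|i _]; last by rewrite /u; field; rewrite ?p0 ?q0.
  by rewrite sum_quadratic -/(signsum eps); field; rewrite ?p0 ?q0.
by field; rewrite ?p0 ?q0.
Qed.

(** On pairs of zero-sum vectors the hypothesis makes [signform + W] positive. Composed with the two
    projections it has diagonal blocks [centred_diag] and off-diagonal blocks [- centred], and the
    Schur product theorem applies to the whole block matrix. *)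
Lemma trace_bound (W : R) :
  (forall a b, \sum_i a i = 0 -> \sum_j b j = 0 ->
    0 <= signform eps a b + W * (\sum_i a i ^+ 2 + \sum_j b j ^+ 2)) ->
  2 * (\sum_i \sum_j centred i j ^+ 2)
  <= \sum_i (W + r i) ^+ 2 + \sum_j (W + c j) ^+ 2.
Proof.
move=> posW; have p0 : p != 0 by rewrite gt_eqF.
have q0 : q != 0 by rewrite gt_eqF.
pose A (u v : P + Q) : R := match u, v with
  | inl i, inl i' => centred_diag (fun i => W + r i) i i'
  | inr j, inr j' => centred_diag (fun j => W + c j) j j'
  | inl i, inr j => - centred i j
  | inr j, inl i => - centred i j end.
have symD (I : finType) (x : I -> R) i j : centred_diag x i j = centred_diag x j i.
  by rewrite /centred_diag eq_sym [x i + _]addrC; case: eqP => [->|_] //; rewrite !mul0r.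
have symA u v : A u v = A v u by case: u v => [i|i] [j|j] //=.
have formA z : 0 <= \sum_u \sum_v A u v * z u * z v.
  pose a i := z (inl i); pose b j := z (inr j).
  pose sa := (\sum_i a i) / p; pose sb := (\sum_j b j) / q.
  have -> : \sum_u \sum_v A u v * z u * z v
    = \sum_i \sum_i' centred_diag (fun i => W + r i) i i' * a i * a i'
    + \sum_j \sum_j' centred_diag (fun j => W + c j) j j' * b j * b j'
    - 2 * \sum_i \sum_j centred i j * a i * b j.
    rewrite sum_sides; under eq_bigr do rewrite sum_sides.
    under [X in _ + X]eq_bigr do rewrite sum_sides.
    rewrite !big_split /= [X in _ + (X + _)]exchange_big /=.
    have -> : \sum_i \sum_j - centred i j * z (inr j) * z (inl i)
      = - \sum_i \sum_j centred i j * a i * b j.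
      rewrite -sumrN; apply: eq_bigr => i _; rewrite -sumrN; apply: eq_bigr => j _.
      by rewrite /a /b; ring.
    have -> : \sum_i \sum_j - centred i j * z (inl i) * z (inr j)
      = - \sum_i \sum_j centred i j * a i * b j.
      rewrite -sumrN; apply: eq_bigr => i _; rewrite -sumrN; apply: eq_bigr => j _.
      by rewrite /a /b; ring.
    by rewrite /a /b; ring.
  rewrite !centred_diag_form // -/sa -/sb.
  have crossE : \sum_i \sum_j centred i j * a i * b j
    = \sum_i \sum_j eps i j * (a i - sa) * (b j - sb).
    transitivity (\sum_i \sum_j eps i j * a i * b j - (\sum_i r i * a i) * sb
      - sa * (\sum_j c j * b j) + sigma * sa * sb).
      rewrite (eq_bigr (fun i => \sum_j eps i j * a i * b j - r i * a i * sb
        - a i * ((\sum_j c j * b j) / p) + a i * (sigma / p * sb))) => [|i _].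
        rewrite big_split !sumrB /= -!mulr_suml.
        have -> : \sum_i a i = sa * p by rewrite divfK.
        by field.
      rewrite (eq_bigr (fun j => eps i j * a i * b j - (r i * a i / q) * b j
        - (a i / p) * (c j * b j) + (a i * sigma / (p * q)) * b j)) => [|j _].
        rewrite big_split !sumrB /= -!mulr_sumr.
        have -> : \sum_j b j = sb * q by rewrite divfK.
        by field; rewrite ?p0 ?q0.
      by rewrite /centred; field; rewrite ?p0 ?q0.
    symmetry; rewrite (eq_bigr (fun i => \sum_j eps i j * a i * b j
      - r i * a i * sb - sa * (\sum_j eps i j * b j) + r i * (sa * sb))) => [|i _].
      by rewrite big_split !sumrB /= -!mulr_suml -mulr_sumr (sum_eps_col eps) -/(signsum eps) mulrA.
    rewrite (eq_bigr (fun j => eps i j * a i * b j - (a i * sb) * eps i j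
      - sa * (eps i j * b j) + (sa * sb) * eps i j)) => [|j _]; last by ring.
    by rewrite big_split !sumrB /= -!mulr_sumr -/(rowsum eps i); ring.
  rewrite crossE; have := posW (fun i => a i - sa) (fun j => b j - sb).
  rewrite (sum_dev _ erefl) // (sum_dev _ erefl) // => /(_ erefl erefl).
  rewrite signformE; congr (0 <= _).
  have split_sum (I : finType) (x y : I -> R) :
    \sum_i (W + x i) * y i ^+ 2 = W * \sum_i y i ^+ 2 + \sum_i x i * y i ^+ 2.
    by rewrite mulr_sumr -big_split; apply: eq_bigr => i _; rewrite mulrDl.
  by rewrite !(split_sum _ _ (fun i => _ - _)); ring.
(* The opposite signs count the squares of the off-diagonal blocks negatively, hence bound them by
   those of the diagonal blocks. *)
have := Schur_square_psd (sides (fun=> 1) (fun=> -1)) symA formA.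
rewrite sum_sides; under eq_bigr do rewrite sum_sides.
under [X in _ + X]eq_bigr do rewrite sum_sides.
rewrite !big_split /= [X in _ + (X + _)]exchange_big /=.
have signE (k : R) (I J : finType) (F : I -> J -> R) (x y : R) :
  x * y = k -> \sum_i \sum_j F i j ^+ 2 * x * y = k * \sum_i \sum_j F i j ^+ 2.
  move=> xy; rewrite mulr_sumr; apply: eq_bigr => i _; rewrite mulr_sumr.
  by apply: eq_bigr => j _; rewrite -mulrA xy mulrC.
have signN (x y : R) : x * y = -1 -> \sum_i \sum_j (- centred i j) ^+ 2 * x * y
    = - \sum_i \sum_j centred i j ^+ 2.
  move=> xy; rewrite (signE _ _ _ (fun i j => - centred i j) _ _ xy) mulN1r.
  by under eq_bigr do under eq_bigr do rewrite sqrrN.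
rewrite (signE 1 _ _ (centred_diag (fun i => W + r i)) 1 1) ?mulr1 //.
rewrite (signE 1 _ _ (centred_diag (fun j => W + c j)) (-1) (-1)) ?mulrNN ?mulr1 //.
rewrite (signN 1 (-1)) ?mul1r //.
have -> : \sum_i \sum_j (- centred i j) ^+ 2 * -1 * 1 = - \sum_i \sum_j centred i j ^+ 2.
  by apply: signN; rewrite mulr1.
have := centred_diag_sqr (fun i => W + r i) p_gt0.
have := centred_diag_sqr (fun j => W + c j) q_gt0.
set x1 := \sum_i _; set x2 := \sum_i _; set x3 := \sum_i _; set x4 := \sum_i _;
  set x5 := \sum_i _; lra.
Qed.

End SignedTrace.

(** * Sides whose sizes differ by at least three *)

(** Here [tau = - sigma]. Since [n^2 - 4 K = (q - p)^2 >= 9], one gets [K > 9 tau > 9 (n - 1) / 2]: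
    the left side of the trace inequality is close to [2 K], hence of size at least about [9 n],
    while the right side is close to [4 n]. *)
Lemma unbalanced_contradiction (R : realFieldType) (p q tau Vr Vc : R) :
  let n := p + q in let K := p * q in let W := 2 + 2 * tau / n + n^-1 in
  1 <= p -> 1 <= q -> 9 <= n ^+ 2 - 4 * K -> 0 <= Vr -> 0 <= Vc ->
  tau * (n ^+ 2 - 4 * K) < K -> n - 1 < 2 * tau ->
  n ^+ 2 * (Vr + Vc) < (K - tau * (n ^+ 2 - 4 * K)) * (n + (1 + 4 * tau) / n) ->
  2 * (K - (Vr + tau ^+ 2 / p) / q - (Vc + tau ^+ 2 / q) / p + tau ^+ 2 / K)
  <= (p * W ^+ 2 - 2 * W * tau + (Vr + tau ^+ 2 / p))
     + (q * W ^+ 2 - 2 * W * tau + (Vc + tau ^+ 2 / q)) ->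
  False.
Proof.
move=> n K W p1 q1 D9 Vr0 Vc0 tD nt.
have n2 : 2 <= n by rewrite /n; lra.
have K0 : 0 < K by rewrite /K mulr_gt0; lra.
have t0 : 0 < tau by lra.
have t9 : 9 * tau < K by apply: le_lt_trans tD; rewrite mulrC ler_wpM2l // ltW.
have Kn : 4 * K <= n ^+ 2 - 9 by lra.
(* The chain [9 (n - 1) / 2 < 9 tau < K <= (n^2 - 9) / 4] means [n^2 - 18 n + 9 > 0], and [n > 3]
   rules out the smaller root. *)
have n17 : 17 < n.
  have n3 : 3 < n by rewrite ltNge; apply/negP => n3; have := ler_pM _ _ n3 n3; lra.
  by rewrite ltNge; apply/negP => ?; nra.
have n0 : 0 < n by lra.
have p0 : 0 < p by lra. have q0 : 0 < q by lra.
set V := Vr + Vc; set D := n ^+ 2 - 4 * K in D9 tD *.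
have V0 : 0 <= V by rewrite addr_ge0.
move=> hV htr.
have Vn : V <= 3 / 10 * n.
  have hV1 : n ^+ 2 * V < K * (n + (1 + 4 * tau) / n).
    apply: lt_le_trans hV _; rewrite ler_wpM2r //; last first.
      by rewrite gerDl oppr_le0 mulr_ge0; lra.
    by rewrite addr_ge0 ?divr_ge0 //; lra.
  have hV2 : n + (1 + 4 * tau) / n <= 6 / 5 * n.
    rewrite -(ler_pM2r n0) mulrDl divfK ?gt_eqF //.
    have := ler_wpM2l (ltW n0) (ltW n17); lra.
  have hV3 : n ^+ 2 * V <= n ^+ 2 * (3 / 10 * n).
    have := ler_wpM2l (ltW K0) hV2; have := ler_wpM2r (ltW n0) Kn; lra.
  by move: hV3; rewrite ler_pM2l // exprn_gt0.
have tn : tau / n <= tau / 17 by rewrite ler_wpM2l ?(ltW t0) // lef_pV2 ?posrE //; lra.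
have in1 : n^-1 <= 1 by rewrite invf_le1 //; lra.
have tDn : tau ^+ 2 * D / (n * K) <= tau / n.
  rewrite ler_pdivrMr ?mulr_gt0 // mulrA divfK ?gt_eqF // expr2 -mulrA.
  by rewrite ler_pM2l // ltW.
have tK : tau ^+ 2 / K <= tau / 9.
  by rewrite ler_pdivrMr //; have := ler_wpM2l (ltW t0) (ltW t9); lra.
have Vrq : Vr / q <= Vr by rewrite ler_pdivrMr // ler_peMr.
have Vcp : Vc / p <= Vc by rewrite ler_pdivrMr // ler_peMr.
have LHS : 2 * (K - (Vr + tau ^+ 2 / p) / q - (Vc + tau ^+ 2 / q) / p + tau ^+ 2 / K)
  = 2 * K - 2 * (Vr / q) - 2 * (Vc / p) - 2 * (tau ^+ 2 / K).
  by rewrite /K; field; rewrite !gt_eqF.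
have RHS : (p * W ^+ 2 - 2 * W * tau + (Vr + tau ^+ 2 / p))
     + (q * W ^+ 2 - 2 * W * tau + (Vc + tau ^+ 2 / q))
  = 4 * n + 4 + n^-1 + tau ^+ 2 * D / (n * K) + V.
  rewrite /W /D /V /K /n; field; rewrite !gt_eqF //.
rewrite LHS RHS in htr.
by rewrite -/V in Vrq Vcp *; have VE : V = Vr + Vc by []; lra.
Qed.

(** * Integer degrees on sides of consecutive sizes *)

(** No integer lies strictly between [k] and [k + 1], so [(h - k) (h - k - 1) >= 0] for each
    value. *)
Lemma sum_sqr_int_ge (R : realDomainType) (I : finType) (h : I -> nat) (k : nat) :
  (2 * k%:R + 1) * (\sum_i (h i)%:R) - k%:R * (k%:R + 1) * #|I|%:R
  <= \sum_i (h i)%:R ^+ 2 :> R.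
Proof.
rewrite mulr_sumr [X in _ - X]mulrC -sum_constr -sumrB; apply: ler_sum => i _.
rewrite -subr_ge0; have -> : (h i)%:R ^+ 2 - ((2 * k%:R + 1) * (h i)%:R - k%:R * (k%:R + 1))
  = ((h i)%:R - k%:R) * ((h i)%:R - (k%:R + 1)) :> R by ring.
have [hk|hk] := leqP (h i) k.
  by rewrite mulr_le0 // subr_le0 ?natr1 ler_nat // ltnW.
by rewrite mulr_ge0 // subr_ge0 ?natr1 ler_nat // ltnW.
Qed.

(* Here [C = A * M + S] is the division of the common degree sum by the size
   of the smaller side; the bounds below are [sum_sqr_int_ge] with [k] the
   integer part of the mean degree, which on the larger side is [A] or
   [A - 1]. *)
Section NearBalanced.
Variables (R : realFieldType) (M A S : R).
Hypotheses (A0 : 0 <= A) (S0 : 0 <= S) (SM : S + 1 <= M) (AM : 2 * A + 1 <= M).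
Local Notation C := (A * M + S).

Let M_gt0 : 0 < M. Proof. move: A0 AM; lra. Qed.
Let M21 : 0 < 2 * M + 1. Proof. move: M_gt0; lra. Qed.
Let M1_gt0 : 0 < M + 1. Proof. move: M_gt0; lra. Qed.
Let d_gt0 : 0 < M * (M + 1) * (2 * M + 1). Proof. by rewrite !mulr_gt0. Qed.

Let AMM : 0 <= (M - A) * (2 * M + 1) - M * (M + 1).
Proof.
have : (M + 1) / 2 <= M - A by move: AM; lra.
by move=> /(ler_wpM2r (ltW M21)); move: M_gt0; lra.
Qed.

Lemma near_balanced_same : A <= S ->
  C / (2 * M + 1) <= ((2 * A + 1) * C - A * (A + 1) * M - C ^+ 2 / M)
    + ((2 * A + 1) * C - A * (A + 1) * (M + 1) - C ^+ 2 / (M + 1)).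
Proof.
(* [w] is the remainder on the larger side: [C = A (M + 1) + w]. *)
move=> AS; pose w := S - A; have w0 : 0 <= w by rewrite subr_ge0.
rewrite -(ler_pM2r d_gt0) -subr_ge0.
set E := (X in 0 <= X).
have -> : E = A * (M + 1) * ((M - A) * (2 * M + 1) - M * (M + 1))
   + w * ((M + 1 - w) * M * (2 * M + 1) - M * (M + 1)
          + (M - S) * (M + 1) * (2 * M + 1) - A * (M + 1) * (2 * M + 1)).
  by rewrite /E /w; field; rewrite !gt_eqF.
rewrite addr_ge0 ?mulr_ge0 ?(ltW M1_gt0) //.
have e1 : 0 <= (M - S) * (M + 1) * (2 * M + 1).
  by rewrite !mulr_ge0 ?(ltW M21) ?(ltW M1_gt0) ?(ltW M_gt0) // subr_ge0; move: SM; lra.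
have e2 : (2 + A) * (M * (2 * M + 1)) <= (M + 1 - w) * (M * (2 * M + 1)).
  by rewrite ler_wpM2r ?mulr_ge0 ?(ltW M21) ?(ltW M1_gt0) ?(ltW M_gt0) // /w; move: SM; lra.
have e3 : 0 <= (M - 2 * A) * (2 * M + 1).
  by rewrite mulr_ge0 ?(ltW M21) ?(ltW M1_gt0) ?(ltW M_gt0) //; move: AM; lra.
have e4 : 0 <= (M - 1) * M.
  by rewrite mulr_ge0 ?(ltW M_gt0) //; move: A0 AM; lra.
by move: M_gt0; lra.
Qed.

Lemma near_balanced_pred : S + 1 <= A ->
  C / (2 * M + 1) <= ((2 * A + 1) * C - A * (A + 1) * M - C ^+ 2 / M)
    + ((2 * (A - 1) + 1) * C - (A - 1) * (A - 1 + 1) * (M + 1) - C ^+ 2 / (M + 1)).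
Proof.
(* On the larger side [C = (A - 1) (M + 1) + (M + 1 - v)]. *)
move=> SA; pose v := A - S.
rewrite -(ler_pM2r d_gt0) -subr_ge0.
set E := (X in 0 <= X).
have -> : E = S * (M + 1) * ((M - S) * (2 * M + 1) - M * (M + 1))
   + v * M * ((M + 1 - v) * (2 * M + 1) - M * (M + 1)).
  by rewrite /E /v; field; rewrite !gt_eqF.
have h1 : (M - A) * (2 * M + 1) <= (M - S) * (2 * M + 1).
  by rewrite ler_wpM2r ?(ltW M21) ?(ltW M1_gt0) ?(ltW M_gt0) //; lra.
have h2 : (M - A) * (2 * M + 1) <= (M + 1 - v) * (2 * M + 1).
  by rewrite ler_wpM2r ?(ltW M21) ?(ltW M1_gt0) ?(ltW M_gt0) // /v; move: S0; lra.
have v0 : 0 <= v by rewrite /v; lra.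
by rewrite addr_ge0 // mulr_ge0 ?mulr_ge0 ?(ltW M1_gt0) ?(ltW M_gt0) //; move: AMM; lra.
Qed.

End NearBalanced.

(** For [0 < c < m (m + 1)] the means [c / m] and [c / (m + 1)] cannot both be integers, so integer
    degrees must deviate from them on at least one side; this quantifies the deviation. *)
Lemma sum_sqr_near_balanced (R : realFieldType) (P Q : finType) (h : P -> nat)
    (g : Q -> nat) (m c : nat) :
  #|P| = m -> #|Q| = m.+1 -> \sum_i h i = c -> \sum_j g j = c ->
  (c.*2 < m ^ 2)%N ->
  c%:R / (2 * m%:R + 1)
  <= \sum_i (h i)%:R ^+ 2 - c%:R ^+ 2 / m%:R
     + (\sum_j (g j)%:R ^+ 2 - c%:R ^+ 2 / (m%:R + 1)) :> R.
Proof.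
move=> Pm Qm hc gc c2m.
have m0 : (0 < m)%N by case: m c2m {Pm Qm}.
pose a := (c %/ m)%N; pose s := (c %% m)%N.
have cE : c = (a * m + s)%N by exact: divn_eq.
have sm : (s < m)%N by rewrite ltn_mod.
have am : (a.*2.+1 <= m)%N.
  by move: c2m; rewrite cE; nia.
have PH k : (2 * k%:R + 1) * c%:R - k%:R * (k%:R + 1) * m%:R <= \sum_i (h i)%:R ^+ 2 :> R.
  by rewrite -{1}hc natr_sum -Pm; apply: sum_sqr_int_ge.
have QH k : (2 * k%:R + 1) * c%:R - k%:R * (k%:R + 1) * (m%:R + 1)
    <= \sum_j (g j)%:R ^+ 2 :> R.
  by rewrite -{1}gc natr_sum (natr1 m) -Qm; apply: sum_sqr_int_ge.
have cR : c%:R = a%:R * m%:R + s%:R :> R by rewrite {1}cE natrD natrM.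
have a0 : 0 <= a%:R :> R by rewrite ler0n.
have s0 : 0 <= s%:R :> R by rewrite ler0n.
have sM : s%:R + 1 <= m%:R :> R by rewrite natr1 ler_nat.
have aM : 2 * a%:R + 1 <= m%:R :> R by rewrite mulr_natl -mulrnA muln2 natr1 ler_nat.
have [aS|Sa] := leqP a s.
  apply: le_trans (lerD (lerB (PH a) (lexx _)) (lerB (QH a) (lexx _))).
  by rewrite cR; apply: near_balanced_same; rewrite // ler_nat.
apply: le_trans (lerD (lerB (PH a) (lexx _)) (lerB (QH a.-1) (lexx _))).
have -> : a.-1%:R = a%:R - 1 :> R by rewrite -subn1 natrB // (leq_trans _ Sa).
by rewrite cR; apply: near_balanced_pred; rewrite // natr1 ler_nat.
Qed.

Lemma signed_contradiction (R : rcfType) (P Q : finType) (eps : P -> Q -> R) :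
  let p : R := #|P|%:R in let q : R := #|Q|%:R in let sigma := signsum eps in
  (forall i j, eps i j ^+ 2 = 1) -> (0 < #|P|)%N ->
  (#|Q| == #|P|.+1) || (#|P| + 3 <= #|Q|)%N -> sigma <= 0 ->
  (forall (a : P -> R) (b : Q -> R), \sum_i a i + \sum_j b j = 0 ->
    0 < \sum_i a i ^+ 2 + \sum_j b j ^+ 2 ->
    - theta eps * (\sum_i a i ^+ 2 + \sum_j b j ^+ 2) < signform eps a b) ->
  (forall (a : P -> R) (b : Q -> R), \sum_i a i = 0 -> \sum_j b j = 0 ->
    0 <= signform eps a b + (2 - 2 * sigma / (p + q) + (p + q)^-1)
      * (\sum_i a i ^+ 2 + \sum_j b j ^+ 2)) ->
  False.
Proof.
move=> p q sigma sgn P0 sizes sig0 form_gt form_ge.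
have Q0 : (0 < #|Q|)%N by case/orP: sizes => [/eqP->|] //; apply: leq_trans; rewrite addn3.
have p0 : 0 < p by rewrite ltr0n.
have q0 : 0 < q by rewrite ltr0n.
have hdev := dev_bound sgn p0 q0 form_gt sig0.
have hlarge := total_large sgn p0 q0 form_gt sig0.
have himb := total_imbalance p0 q0 form_gt.
have hvr := Vrow_ge0 eps p0.
have hvc := Vcol_ge0 eps q0.
have htr := trace_bound p0 q0 form_ge.
rewrite sum_centred_sqr // in htr.
rewrite -/p -/q -/sigma in hdev hlarge himb hvr hvc htr.
have hr2 : \sum_i rowsum eps i ^+ 2 = Vrow eps + sigma ^+ 2 / p by rewrite subrK.
have hc2 : \sum_j colsum eps j ^+ 2 = Vcol eps + sigma ^+ 2 / q by rewrite subrK.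
case/orP: sizes => [/eqP Qm|Pm3]; last first.
  apply: (@unbalanced_contradiction _ p q (- sigma) (Vrow eps) (Vcol eps)) => //.
  - by rewrite ler1n.
  - by rewrite ler1n.
  - have pq3 : p + 3 <= q by rewrite -natrD ler_nat.
    have h3 : 3 <= q - p by lra.
    have h9 : 3 * 3 <= (q - p) * (q - p) by apply: ler_pM => //; lra.
    lra.
  - lra.
  - have -> : p * q - - sigma * ((p + q) ^+ 2 - 4 * (p * q))
      = p * q + sigma * ((p + q) ^+ 2 - 4 * (p * q)) by ring.
    have -> : (1 + 4 * - sigma) / (p + q) = theta eps; last by [].
    by rewrite /theta -/sigma; congr (_ / _); ring.
  - set W := 2 + _ + _.
    have WE : W = 2 - 2 * sigma / (p + q) + (p + q)^-1 by rewrite /W; ring.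
    rewrite -WE in htr; rewrite !sqrrN -hr2 -hc2.
    have sqE (I : finType) (x : I -> R) (s : R) : s = \sum_i x i ->
      \sum_i (W + x i) ^+ 2 = #|I|%:R * W ^+ 2 - 2 * W * - s + \sum_i x i ^+ 2.
      move=> ->; rewrite (eq_bigr (fun i => W ^+ 2 + 2 * W * x i + 1 * x i ^+ 2)) => [|i _].
        by rewrite sum_quadratic; ring.
      by ring.
    by move: htr; rewrite (sqE _ _ sigma erefl) (sqE _ _ sigma (total_colsum eps)).
(* Case [q = p + 1]: counting the signs [+1] replaces the signed degrees by natural numbers with
   common sum [cn]. *)
pose h i := (\sum_j (eps i j == 1)%R)%N; pose g j := (\sum_i (eps i j == 1)%R)%N.
pose cn := (\sum_i h i)%N; have gc : (\sum_j g j = cn)%N by rewrite exchange_big.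
have epsE i j : eps i j = 2 * (eps i j == 1)%:R - 1.
  have /eqP := sgn i j; rewrite sqrf_eq1 => /orP[] /eqP ->; rewrite ?eqxx.
    by rewrite /=; ring.
  have -> : (-1 == 1 :> R) = false by apply/eqP => e; lra.
  by rewrite /=; ring.
have rE i : rowsum eps i = 2 * (h i)%:R - q.
  rewrite /rowsum; under eq_bigr do rewrite epsE.
  by rewrite sumrB -mulr_sumr sum_constr mulr1 natr_sum.
have cE j : colsum eps j = 2 * (g j)%:R - p.
  rewrite /colsum; under eq_bigr do rewrite epsE.
  by rewrite sumrB -mulr_sumr sum_constr mulr1 natr_sum.
have sigE : sigma = 2 * cn%:R - p * q.
  rewrite /sigma /signsum; under eq_bigr do rewrite rE.
  by rewrite sumrB -mulr_sumr sum_constr natr_sum.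
have qE : q = p + 1 by rewrite /q Qm natr1.
have c2 : (cn.*2 < #|P| ^ 2)%N.
  rewrite -(ltr_nat R) -muln2 natrM natrX -/p.
  by move: hlarge; rewrite sigE qE; lra.
pose Sh : R := \sum_i (h i)%:R ^+ 2; pose Sg : R := \sum_j (g j)%:R ^+ 2.
have := sum_sqr_near_balanced R erefl Qm erefl gc c2.
rewrite -/p -/cn -/Sh -/Sg => hS.
have VrE : Vrow eps = 4 * (Sh - cn%:R ^+ 2 / p).
  rewrite /Vrow -/sigma sigE.
  rewrite (eq_bigr (fun i => q ^+ 2 + (- 4 * q) * (h i)%:R + 4 * (h i)%:R ^+ 2)) => [|i _];
    last by rewrite rE; ring.
  by rewrite sum_quadratic -natr_sum -/cn -/Sh -/p; field; rewrite gt_eqF.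
have VcE : Vcol eps = 4 * (Sg - cn%:R ^+ 2 / q).
  rewrite /Vcol -/sigma sigE.
  rewrite (eq_bigr (fun j => p ^+ 2 + (- 4 * p) * (g j)%:R + 4 * (g j)%:R ^+ 2)) => [|j _];
    last by rewrite cE; ring.
  by rewrite sum_quadratic -natr_sum gc -/Sg -/q; field; rewrite gt_eqF.
have n0 : 0 < p + q by lra.
have nE : p + q = 2 * p + 1 by rewrite qE; ring.
have thE : (p + q) * theta eps = (p + q) ^+ 2 - 8 * cn%:R.
  rewrite /theta -/sigma -/p -/q sigE mulrC divfK ?gt_eqF // qE; ring.
have dE : (p + q) ^+ 2 - 4 * (p * q) = 1 by rewrite qE; ring.
rewrite dE VrE VcE in hdev.
have {}hS : cn%:R <= (p + q) * (Sh - cn%:R ^+ 2 / p + (Sg - cn%:R ^+ 2 / q)).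
  by rewrite mulrC -ler_pdivrMr // {1}nE qE.
move: hdev hS; set S := Sh - _ + _ => hdev hS.
have {}hdev : (p + q) ^+ 2 * (4 * S) * (p + q)
    < 2 * cn%:R * (2 * (p + q) ^+ 2 - 8 * cn%:R).
  have -> : 2 * cn%:R * (2 * (p + q) ^+ 2 - 8 * cn%:R)
    = (p * q + sigma * 1) * (p + q + theta eps) * (p + q).
    transitivity ((p * q + sigma) * ((p + q) ^+ 2 + (p + q) * theta eps)).
      by rewrite thE sigE; ring.
    by ring.
  rewrite ltr_pM2r //; move: hdev; rewrite /S; lra.
(* Integrality and [dev_bound] now give [4 n^2 cn <= 4 n^3 S < 4 n^2 cn - 16 cn^2]. *)
have := ler_wpM2l (sqr_ge0 (p + q)) hS; have := sqr_ge0 (cn%:R : R).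
lra.
Qed.

(** * Lower bounds on the energy *)

Section EnergyBound.
Variables (R : rcfType) (P Q : finType) (d : P + Q -> P + Q -> nat) (E : R).
Local Notation p := (#|P|%:R : R).
Local Notation q := (#|Q|%:R : R).
Local Notation n := (p + q).
Local Notation D := (fun u v : P + Q => (d u v)%:R : R).
Local Notation t := (mean_trans D).

Hypotheses (P_gt0 : (0 < #|P|)%N) (PQ : (#|P| <= #|Q|)%N).
Hypothesis d_sym : forall u v, d u v = d v u.
Hypothesis d_refl : forall u, d u u = 0%N.
Hypothesis d_rows : forall i i' : P, i != i' -> (1 < d (inl i) (inl i'))%N.
Hypothesis d_cols : forall j j' : Q, j != j' -> (1 < d (inr j) (inr j'))%N.
Hypothesis d_cross : forall i j, odd (d (inl i) (inr j)).
Hypothesis d_step : forall i j, exists j',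
  (d (inl i) (inr j) <= (d (inr j') (inr j)).+1)%N.
Hypothesis energy_ge : forall z y : P + Q -> R,
  \sum_u z u = 0 -> \sum_u y u = 0 -> dot z y = 0 ->
  2 * t - 2 * ((lapform D z - t * dot z z) / dot z z)
    - 2 * ((lapform D y - t * dot y y) / dot y y) <= E.

Let p_gt0 : 0 < p. Proof. by rewrite ltr0n. Qed.
Let q_gt0 : 0 < q. Proof. by rewrite ltr0n (leq_trans P_gt0). Qed.
Let n_gt0 : 0 < n. Proof. exact: addr_gt0. Qed.
Let pq_gt0 : 0 < p * q. Proof. exact: mulr_gt0. Qed.
Let card_sum_R : #|{: P + Q}|%:R = n :> R.
Proof. by rewrite card_sum natrD. Qed.

(** The truncated subtractions are exact, as [excessE] shows from the parity and the lower bounds on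
    [d]. *)
Definition excess u v : nat :=
  match u, v with
  | inl i, inl i' => d u v - (i != i').*2
  | inr j, inr j' => d u v - (j != j').*2
  | _, _ => (d u v).-1
  end.

Arguments excess : simpl never.

Definition cross_excess : nat := \sum_i \sum_j excess (inl i) (inr j).
(** Summed over ordered pairs, hence each pair twice, whereas [cross_excess] takes each pair once:
    the full matrix has excess [2 C + I2]. *)
Definition side_excess : nat :=
  \sum_i \sum_i' excess (inl i) (inl i') + \sum_j \sum_j' excess (inr j) (inr j').
Local Notation C := (cross_excess%:R : R).
Local Notation I2 := (side_excess%:R : R).

Lemma excessE u v : (d u v)%:R = distK R u v + (excess u v)%:R.
Proof.
have two (b : bool) : 2 * b%:R = (b.*2)%:R :> R by rewrite -natrM -mul2n.
have c0 i j : (0 < d (inl i) (inr j))%N by have := d_cross i j; case: (d _ _).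
case: u v => [i|i] [j|j]; rewrite /excess /distK ?two.
- rewrite -natrD subnKC //; have [->|ij] := eqVneq i j; first by rewrite leq0n.
  exact: d_rows.
- by rewrite addrC natr1 prednK.
- by rewrite addrC natr1 prednK // d_sym.
- rewrite -natrD subnKC //; have [->|ij] := eqVneq i j; first by rewrite leq0n.
  exact: d_cols.
Qed.

Lemma mean_transE : t = 2 * (n - 1) + (2 * C + I2 - 2 * (p * q)) / n.
Proof.
have -> : t = (2 * (n ^+ 2 - n - p * q) + (2 * C + I2)) / n; last first.
  by field; rewrite gt_eqF.
rewrite /mean_trans card_sum_R -sum_distK; congr (_ / _).
under eq_bigr do under eq_bigr do rewrite excessE.
under eq_bigr do rewrite big_split.
rewrite big_split; congr (_ + _) => /=.
rewrite sum_sides; under eq_bigr do rewrite sum_sides.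
under [X in _ + X]eq_bigr do rewrite sum_sides.
rewrite !big_split /= [X in _ + (X + _)]exchange_big /=.
have -> : \sum_i \sum_j (excess (inr j) (inl i))%:R = C.
  rewrite natr_sum; apply: eq_bigr => i _; rewrite natr_sum.
  by apply: eq_bigr => j _; rewrite /excess d_sym.
have -> : \sum_i \sum_j (excess (inl i) (inr j))%:R = C.
  by rewrite natr_sum; apply: eq_bigr => i _; rewrite natr_sum.
have -> : I2 = \sum_i \sum_i' (excess (inl i) (inl i'))%:R
    + \sum_j \sum_j' (excess (inr j) (inr j'))%:R.
  by rewrite natrD !natr_sum; congr (_ + _); apply: eq_bigr => k _; rewrite natr_sum.
by ring.
Qed.

Lemma energy_ge1 (z : P + Q -> R) : \sum_u z u = 0 ->
  2 * t - 2 * ((lapform D z - t * dot z z) / dot z z) <= E.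
Proof.
move=> z0; have := @energy_ge z (fun=> 0) z0.
have -> : lapform D (fun=> 0) = 0.
  rewrite /lapform big1 ?mulr0 // => u _; rewrite big1 // => v _.
  by rewrite subrr expr0n mulr0.
have d0 (x : P + Q -> R) : dot x (fun=> 0) = 0.
  by apply: big1 => u _; rewrite mulr0.
rewrite !d0 big1 // => /(_ erefl erefl).
by rewrite !(mulr0, mul0r, subr0).
Qed.

(** The centred unit vector at [u] has Rayleigh quotient [n / (n - 1)] times the transmission of
    [u], and the transmissions average to [t]. *)
Lemma energy_ge_trans : 1 < n -> t * (2 * n - 4) / (n - 1) <= E.
Proof.
move=> n1; pose T u : R := \sum_v D u v.
have sumT : \sum_u T u = t * n.
  by rewrite /mean_trans card_sum_R divfK // gt_eqF.
have point u : 4 * t - 2 * n / (n - 1) * T u <= E.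
  pose e (v : P + Q) : R := (v == u)%:R; pose z v := e v - n^-1.
  have sum_e (F : P + Q -> R) : \sum_v e v * F v = F u.
    rewrite (bigD1 u) //= /e eqxx mul1r big1 ?addr0 // => v /negPf->.
    by rewrite mul0r.
  have e2 v : e v * e v = e v by rewrite /e; case: eqP; rewrite ?mulr1 ?mulr0.
  have se : \sum_v e v = 1.
    by rewrite -[RHS](sum_e (fun=> 1)); apply: eq_bigr => v _; rewrite mulr1.
  have z0 : \sum_v z v = 0.
    by rewrite sumrB se sum_constr card_sum_R divff ?subrr // gt_eqF.
  have zz : dot z z = (n - 1) / n.
    rewrite /dot (eq_bigr (fun v => (1 - 2 / n) * e v + n^-1 ^+ 2)) => [|v _].
      by rewrite big_split /= -mulr_sumr se sum_constr card_sum_R; field; rewrite gt_eqF.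
    have -> : z v * z v = e v * e v - 2 / n * e v + n^-1 ^+ 2 by rewrite /z; ring.
    by rewrite e2; ring.
  have Lz : lapform D z = T u.
    rewrite /lapform (eq_bigr (fun v => e v * T v + \sum_w e w * D v w
      - 2 * (e v * \sum_w e w * D v w))) => [|v _]; last first.
      rewrite !mulr_sumr -big_split -sumrB /=; apply: eq_bigr => w _.
      have -> : (z v - z w) ^+ 2 = e v * e v + e w * e w - 2 * e v * e w.
        by rewrite /z; ring.
      by rewrite !e2; ring.
    rewrite sumrB big_split /= -mulr_sumr.
    under [X in _ + X - _]eq_bigr do rewrite sum_e.
    under [X in _ - _ * X]eq_bigr do rewrite sum_e.
    rewrite !sum_e d_refl.
    have -> : \sum_v D v u = T u by apply: eq_bigr => v _; rewrite d_sym.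
    by field.
  have := energy_ge1 z0; rewrite zz Lz.
  congr (_ <= _); field; rewrite !gt_eqF //; lra.
have : \sum_u (4 * t - 2 * n / (n - 1) * T u) <= \sum_(u : P + Q) E.
  exact: ler_sum.
rewrite sumrB -!mulr_sumr sumT !sum_constr card_sum_R => h.
rewrite -(ler_pM2l n_gt0); move: h; congr (_ <= _).
by field; rewrite gt_eqF //; lra.
Qed.

Let bal : P + Q -> R := sides (fun=> q) (fun=> - p).

Lemma bal_sum : \sum_u bal u = 0.
Proof. by rewrite sum_sides /= !sum_constr; ring. Qed.

Lemma bal_dot : dot bal bal = n * (p * q).
Proof. by rewrite dot_sides !sum_constr; ring. Qed.

(** If all distances were [2] the form would consist of the first two terms; the discrepancy is
    [d - 2], nonzero only across. *)
Lemma lapform_excess a b : side_excess = 0%N ->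
  lapform D (sides a b) = 2 * n * (\sum_i a i ^+ 2 + \sum_j b j ^+ 2)
    - 2 * (\sum_i a i + \sum_j b j) ^+ 2
    + signform (fun i j => (excess (inl i) (inr j))%:R - 1) a b.
Proof.
move=> /eqP; rewrite addn_eq0 !sum_nat_eq0 => /andP[/forallP xr /forallP xc].
have {}xr i i' : excess (inl i) (inl i') = 0%N.
  by have := xr i; rewrite sum_nat_eq0 => /forallP/(_ i')/eqP.
have {}xc j j' : excess (inr j) (inr j') = 0%N.
  by have := xc j; rewrite sum_nat_eq0 => /forallP/(_ j')/eqP.
pose X u v : R := (excess u v)%:R.
have symX u v : X u v = X v u.
  by rewrite /X /excess; case: u v => [i|i] [j|j]; rewrite ?[_ == j]eq_sym d_sym.
have -> : lapform D (sides a b) = lapform (distK R (P:=P) (Q:=Q)) (sides a b)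
    + lapform X (sides a b).
  rewrite /lapform -mulrDr -big_split; congr (_ * _); apply: eq_bigr => u _.
  by rewrite -big_split; apply: eq_bigr => v _; rewrite excessE mulrDl.
rewrite lapform_distK (lapform_sides _ _ symX).
rewrite [X in _ + (_ * X + _ + _)]big1 => [|i _]; last first.
  by rewrite big1 // => i' _; rewrite /X xr mul0r.
rewrite [X in _ + (_ + _ * X + _)]big1 => [|j _]; last first.
  by rewrite big1 // => j' _; rewrite /X xc mul0r.
have -> : signform (fun i j => (excess (inl i) (inr j))%:R - 1) a b
  = \sum_i \sum_j X (inl i) (inr j) * (a i - b j) ^+ 2
    - \sum_i \sum_j (a i - b j) ^+ 2.
  rewrite /signform -sumrB; apply: eq_bigr => i _; rewrite -sumrB.
  by apply: eq_bigr => j _; rewrite mulrBl mul1r.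
by rewrite sum_sqr_cross; ring.
Qed.

Lemma lapform_bal : lapform D bal = n ^+ 2 * (p * q + C).
Proof.
pose X u v : R := (excess u v)%:R.
have symX u v : X u v = X v u.
  by rewrite /X /excess; case: u v => [i|i] [j|j]; rewrite ?[_ == j]eq_sym d_sym.
have -> : lapform D bal = lapform (distK R (P:=P) (Q:=Q)) bal + lapform X bal.
  rewrite /lapform -mulrDr -big_split; congr (_ * _); apply: eq_bigr => u _.
  by rewrite -big_split; apply: eq_bigr => v _; rewrite excessE mulrDl.
rewrite lapform_distK (lapform_sides _ _ symX) !sum_constr.
rewrite [X in _ + (_ * X + _ + _)]big1 => [|i _]; last first.
  by rewrite big1 // => i' _; rewrite subrr expr0n mulr0.
rewrite [X in _ + (_ + _ * X + _)]big1 => [|j _]; last first.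
  by rewrite big1 // => j' _; rewrite subrr expr0n mulr0.
under eq_bigr do rewrite -mulr_suml.
rewrite -mulr_suml.
have -> : \sum_i \sum_j X (inl i) (inr j) = C.
  by rewrite natr_sum; apply: eq_bigr => i _; rewrite natr_sum.
by ring.
Qed.

(** [bal] is constant on each side, so excess inside a side raises [t] without changing the form at
    [bal]; this gives the term [4 * I2 / n]. *)
Lemma energy_ge_bal :
  4 * n - 8 + 2 * (n ^+ 2 - 4 * (p * q)) / n * (1 - C / (p * q)) + 4 * I2 / n <= E.
Proof.
have := energy_ge1 bal_sum; rewrite bal_dot lapform_bal mean_transE.
by congr (_ <= _); field; rewrite !gt_eqF.
Qed.

Let p_ge1 : 1 <= p. Proof. by rewrite ler1n. Qed.
Let q_ge1 : 1 <= q. Proof. by rewrite ler1n (leq_trans P_gt0). Qed.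
Let imb_ge0 : 0 <= n ^+ 2 - 4 * (p * q).
Proof. by have := sqr_ge0 (p - q); lra. Qed.

(** The null test vector leaves the bound [2 t], which is sharp for [n = 3]. *)
Lemma energy_ge_twice : 4 * (n - 1) - 4 * (p * q) / n <= E.
Proof.
have z0 : \sum_(u : P + Q) (0 : R) = 0 by rewrite big1.
have := energy_ge1 z0; set S := dot _ _.
have -> : S = 0 by apply: big1 => u _; rewrite mulr0.
rewrite invr0 !(mulr0, subr0) mean_transE; apply: le_trans.
have : 0 <= (2 * C + I2) / n by rewrite divr_ge0 ?(ltW n_gt0) // addr_ge0 ?mulr_ge0.
lra.
Qed.

(** Used with [e = 0] and [e = 1]. The second hypothesis asks for [n >= 3] only when [e > 0]: then
    the factor [(2 n - 4) / (n - 1)] is at least [1] and preserves the gain [2 e / n]. *)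
Lemma energy_ge_large (e : R) : 0 <= e -> 3 * e <= n * e -> p * q + e <= C + I2 / 2 ->
  4 * n - 8 + 2 * e / n <= E.
Proof.
move=> e0 e3 h; have n1 : 1 < n by move: p_ge1 q_ge1; lra.
apply: le_trans (energy_ge_trans n1).
have n10 : 0 < n - 1 by lra.
have t_ge : 2 * (n - 1) + 2 * e / n <= t.
  rewrite mean_transE lerD2l ler_pM2r ?invr_gt0 //; lra.
rewrite ler_pdivlMr //.
have n2 : 0 <= 2 * n - 4 by move: p_ge1 q_ge1; lra.
apply: le_trans (ler_wpM2r n2 t_ge).
have en : 3 * (e / n) <= n * (e / n).
  by rewrite !mulrA ler_pM2r ?invr_gt0.
by lra.
Qed.

Lemma energy_ge_even : 4 * n - 8 <= E.
Proof.
have [h|h] := leP (p * q) (C + I2 / 2).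
  have := @energy_ge_large 0 (lexx _); rewrite !mulr0 addr0 mul0r addr0.
  by apply; rewrite ?lexx.
apply: le_trans energy_ge_bal.
have I0 : 0 <= 4 * I2 / n by rewrite divr_ge0 ?mulr_ge0 ?(ltW n_gt0).
have C1 : 0 <= 1 - C / (p * q).
  rewrite subr_ge0 ler_pdivrMr // mul1r.
  by have : 0 <= I2 by []; lra.
have := mulr_ge0 (divr_ge0 (mulr_ge0 (ler0n R 2) imb_ge0) (ltW n_gt0)) C1.
lra.
Qed.

Lemma energy_ge_odd : odd (#|P| + #|Q|) -> 4 * n - 8 + 2 / n <= E.
Proof.
move=> odd_n.
have I_ge0 : 0 <= I2 by [].
have [large|small] := leqP (2 * (#|P| * #|Q|).+1)%N (2 * cross_excess + side_excess)%N.
  have := @energy_ge_large 1 ler01; rewrite !mulr1; apply.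
    rewrite -natrD ler_nat; move: odd_n P_gt0 PQ.
    by case: #|P| #|Q| => [|[|x]] [|[|y]] //; rewrite !addnS.
  by move: large; rewrite -(ler_nat R) natrM natrD natrM -(natr1 (_ * _)) natrM; lra.
have C_le : (cross_excess <= #|P| * #|Q|)%N.
  by move: small; rewrite mulnS => small; lia.
have CR : C <= p * q by rewrite -natrM ler_nat.
have C1 : 0 <= 1 - C / (p * q) by rewrite subr_ge0 ler_pdivrMr // mul1r.
have [I0|I0] := posnP side_excess; last first.
  apply: le_trans energy_ge_bal.
  have I1 : 1 <= I2 by rewrite ler1n.
  have := mulr_ge0 (divr_ge0 (mulr_ge0 (ler0n R 2) imb_ge0) (ltW n_gt0)) C1.
  have : 2 / n <= 4 * I2 / n by rewrite ler_pM2r ?invr_gt0 //; lra.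
  lra.
rewrite leNgt; apply/negP => E_lt.
pose eps (i : P) (j : Q) : R := (excess (inl i) (inr j))%:R - 1.
(* Without side excess, [d_step] bounds the distances across by [3], and parity leaves [1] and
   [3]. *)
have sgn i j : eps i j ^+ 2 = 1.
  have I00 : forall j', excess (inr j') (inr j) = 0%N.
    move: I0 => /eqP; rewrite addn_eq0 !sum_nat_eq0 => /andP[_ /forallP xc] j'.
    by have := xc j'; rewrite sum_nat_eq0 => /forallP/(_ j)/eqP.
  have [j' hj] := d_step i j.
  have dj : (d (inr j') (inr j) <= 2)%N.
    have := I00 j'; rewrite /excess => /eqP; rewrite subn_eq0 => /leq_trans; apply.
    by case: (_ != _).
  have := d_cross i j; have := leq_trans hj (dj : ((d (inr j') (inr j)).+1 <= 3)%N).
  rewrite /eps /excess; case: (d _ _) => [|[|[|[|k]]]] //= _ _; ring.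
have sigE : signsum eps = C - p * q.
  rewrite /signsum /rowsum /eps; under eq_bigr do rewrite sumrB sum_constr mulr1.
  rewrite sumrB sum_constr; congr (_ - _).
  by rewrite natr_sum; apply: eq_bigr => i _; rewrite natr_sum.
have tE : t = 2 * (n - 1) + 2 * signsum eps / n.
  by rewrite mean_transE I0 sigE addr0; congr (_ + _ / _); ring.
have quot (L Z : R) : Z != 0 -> (L - t * Z) / Z = L / Z - t.
  by move=> Z0; field.
apply: (@signed_contradiction R P Q eps) => //.
- move: PQ odd_n; rewrite leq_eqVlt => /orP[/eqP->|]; first by rewrite addnn odd_double.
  rewrite leq_eqVlt => /orP[/eqP<-|]; first by rewrite eqxx.
  rewrite leq_eqVlt => /orP[/eqP<-|h _]; first by rewrite !addnS /= addnn odd_double.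
  by rewrite addn3 h orbT.
- by rewrite sigE subr_le0.
- move=> a b ab0 ab1; have := @energy_ge1 (sides a b).
  rewrite sum_sides lapform_excess // ab0 dot_sides.
  have -> : \sum_i a i * a i + \sum_j b j * b j = \sum_i a i ^+ 2 + \sum_j b j ^+ 2.
    by congr (_ + _); apply: eq_bigr => ? _; rewrite expr2.
  set Z := \sum_i _ + _ in ab1 *; rewrite -/eps quot ?gt_eqF // => /(_ erefl) h.
  rewrite -ltr_pdivlMr //.
  have NE : (2 * n * Z - 2 * 0 ^+ 2 + signform eps a b) / Z
    = 2 * n + signform eps a b / Z by field; rewrite gt_eqF.
  rewrite NE tE in h; rewrite /theta.
  have -> : (1 - 4 * signsum eps) / n = n^-1 - 4 * (signsum eps / n) by ring.
  by move: h E_lt; lra.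
- move=> a b a0 b0.
  set Z := (X in _ * X).
  have Z_ge0 : 0 <= Z by rewrite addr_ge0 //; apply: sumr_ge0 => ? _; apply: sqr_ge0.
  have ZE : dot (sides a b) (sides a b) = Z.
    by rewrite dot_sides; congr (_ + _); apply: eq_bigr => ? _; rewrite expr2.
  move: Z_ge0; rewrite le_eqVlt => /orP[/eqP Z0|Z_gt0].
    have ab0 := dot_eq0 (etrans ZE (esym Z0)).
    rewrite -Z0 mulr0 addr0 /signform big1 // => i _; rewrite big1 // => j _.
    by have /= -> := ab0 (inl i); have /= -> := ab0 (inr j); rewrite subrr expr0n mulr0.
  have bal_ab : dot bal (sides a b) = 0.
    by rewrite dot_sides -!mulr_sumr a0 b0 !mulr0 addr0.
  have ab0 : \sum_u sides a b u = 0 by rewrite sum_sides /= a0 b0 addr0.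
  (* Zero sum on each side makes the vector orthogonal to [bal], so both may be tested together;
     [bal] has quotient [2 n + n sigma / (p q)]. *)
  have := energy_ge bal_sum ab0 bal_ab.
  rewrite bal_dot lapform_bal ZE lapform_excess // -/Z -/eps a0 b0 !quot ?gt_eqF ?mulr_gt0 //.
  have -> : (2 * n * Z - 2 * (0 + 0) ^+ 2 + signform eps a b) / Z
    = 2 * n + signform eps a b / Z by field; rewrite gt_eqF.
  have -> : n ^+ 2 * (p * q + C) / (n * (p * q)) = 2 * n + n * signsum eps / (p * q).
    by rewrite sigE; field; rewrite !gt_eqF.
  rewrite tE => h.
  have sig0 : signsum eps <= 0 by rewrite sigE subr_le0.
  have ns : n * signsum eps / (p * q) <= 4 * (signsum eps / n).
    rewrite ler_pdivrMr // -(ler_pM2r n_gt0).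
    have -> : 4 * (signsum eps / n) * (p * q) * n = signsum eps * (4 * (p * q)).
      by field; rewrite gt_eqF.
    have := mulr_le0_ge0 sig0 imb_ge0; lra.
  rewrite -[X in X + _](@divfK _ Z) ?gt_eqF // -mulrDl mulr_ge0 ?ltW //.
  by move: h E_lt ns; set x := signform _ _ _ / Z; lra.
Qed.

End EnergyBound.

(** * From graphs to the minimum *)

Lemma bipartite_DLE_ge (R : rcfType) (G : sgraph) :
  connected G -> bipartite G -> (1 < #|G|)%N ->
  exists a b : nat, let n : R := a%:R + b%:R in
  [/\ (a + b)%N = #|G|, (0 < a <= b)%N,
      4 * (n - 1) - 4 * (a%:R * b%:R) / n <= DLE R G,
      4 * n - 8 <= DLE R G &
      odd (a + b) -> 4 * n - 8 + 2 / n <= DLE R G].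
Proof.
move=> conG [A0 bipA0] G1.
have [A [bipA cardA]] : exists A : {set G},
    (forall u v : G, sedge u v -> (u \in A) != (v \in A)) /\ (#|A| <= #|~: A|)%N.
  have [le|lt] := leqP #|A0| #|~: A0|; first by exists A0.
  exists (~: A0); rewrite setCK; split; last exact: ltnW.
  by move=> u v /bipA0; rewrite !inE; case: (_ \in _); case: (_ \in _).
pose P := {x : G | x \in A}; pose Q := {x : G | x \in ~: A}.
have cP : #|{: P}| = #|A| by rewrite card_sig; apply: eq_card => x; rewrite inE.
have cQ : #|{: Q}| = #|~: A| by rewrite card_sig; apply: eq_card => x; rewrite inE.
pose h (u : P + Q) : G := match u with inl x => val x | inr x => val x end.
have sum_card : (#|{: P}| + #|{: Q}|)%N = #|G| by rewrite cP cQ cardsC.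
have inj_h : injective h.
  have disj (x : P) (y : Q) : val x <> val y.
    by move=> e; have := valP y; rewrite -e inE (valP x).
  move=> [x|x] [y|y] e; rewrite /h in e.
  - by congr inl; apply: val_inj.
  - by have := disj x y e.
  - by have := disj y x (esym e).
  - by congr inr; apply: val_inj.
have bij_h : bijective h by apply: inj_card_bij; rewrite // card_sum sum_card.
have [u0 [v0 uv0]] : exists u v : G, u != v.
  have /card_gt1P[u [v [_ _ uv]]] := G1; by exists u, v.
have [w wA _] := sides_nonempty bipA conG uv0.
have P0 : (0 < #|{: P}|)%N by rewrite cP; apply/card_gt0P; exists w.
have PQ : (#|{: P}| <= #|{: Q}|)%N by rewrite cP cQ.
pose d u v := gdist (h u) (h v).
have parity u v : odd (d u v) = ((h u \in A) != (h v \in A)) by apply: odd_gdist.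
have hP (x : P) : h (inl x) \in A by exact: valP.
have hQ (x : Q) : (h (inr x) \in A) = false.
  by have := valP x; rewrite inE => /negPf.
have gt1 u v : u != v -> ~~ odd (d u v) -> (1 < d u v)%N.
  move=> uv; have : (0 < d u v)%N by apply: gdist_gt0; rewrite ?(inj_eq inj_h).
  by case: (d u v) => [|[|k]].
have d_rows (i i' : P) : i != i' -> (1 < d (inl i) (inl i'))%N.
  by move=> ii'; apply: gt1 => //; rewrite parity !hP.
have d_cols (i i' : Q) : i != i' -> (1 < d (inr i) (inr i'))%N.
  by move=> ii'; apply: gt1 => //; rewrite parity !hQ.
have d_cross (i : P) (j : Q) : odd (d (inl i) (inr j)) by rewrite parity hP hQ.
have d_step (i : P) (j : Q) : exists j' : Q,
    (d (inl i) (inr j) <= (d (inr j') (inr j)).+1)%N.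
  have [[|x s] [pp lp _]] := gdistP (h (inl i)) (h (inr j)) conG.
    by have := hQ j; rewrite -lp hP.
  have /andP[ix _] := pp; have := bipA _ _ ix; rewrite hP => xA.
  have xQ : x \in ~: A by rewrite inE; case: (x \in A) xA.
  (* The witness is the second vertex of a shortest path. *)
  exists (Sub x xQ); exact: gdist_step.
have dE u v : (gdist (h u) (h v))%:R = (d u v)%:R :> R by [].
have energy := DLE_lower_bij (R := R) bij_h dE.
rewrite card_sum sum_card in energy.
have {}energy := energy _ _ (ltnW G1).
exists #|{: P}|, #|{: Q}|; split=> //.
- by rewrite P0.
- by apply: energy_ge_twice d_rows d_cols d_cross _ => //; move=> u v; apply: gdist_sym.
- apply: (energy_ge_even P0 PQ _ _ d_rows d_cols d_cross) => //.
    by move=> u v; apply: gdist_sym.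
  by move=> u; apply: gdist_refl.
move=> odd_n; apply: (energy_ge_odd P0 PQ _ _ d_rows d_cols d_cross d_step) => //.
  by move=> u v; apply: gdist_sym.
by move=> u; apply: gdist_refl.
Qed.

Theorem corollary3p2 (R : rcfType) (n : nat) (hn : (3 <= n)%N) :
  [/\ order_of (Kab n./2 (uphalf n)) = n,
      connected (Kab n./2 (uphalf n)),
      bipartite (Kab n./2 (uphalf n)) &
      forall G : sgraph,
        order_of G = n -> connected G -> bipartite G ->
        DLE R (Kab n./2 (uphalf n)) <= DLE R G].
Proof.
have a0 : (0 < n./2)%N by rewrite half_gt0 ltnW.
have b0 : (0 < uphalf n)%N by rewrite uphalf_half addn_gt0 a0 orbT.
have ab_n : (n./2 + uphalf n)%N = n.
  by rewrite uphalf_half addnCA addnn odd_double_half.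
split.
- by rewrite order_Kab.
- exact: connected_Kab.
- exact: bipartite_Kab.
move=> G oG conG bipG.
have G1 : (1 < #|G|)%N by rewrite -/(order_of G) oG ltnW.
have [x [y /= [xy /andP[x0 xley] twice even_ge odd_ge]]] :=
  @bipartite_DLE_ge R G conG bipG G1.
rewrite -/(order_of G) oG in xy.
have xyR : x%:R + y%:R = n%:R :> R by rewrite -natrD xy.
rewrite xyR in twice even_ge odd_ge.
have bal : (n./2 <= uphalf n <= (n./2).+1)%N.
  by rewrite uphalf_half leq_addl /= -add1n leq_add2r leq_b1.
have upper c := @DLE_Kab_upper _ _ a0 b0 R c bal.
rewrite /= ab_n in upper.
have nA : n%:R = (n./2)%:R + (uphalf n)%:R :> R by rewrite -natrD ab_n.
have BE : (uphalf n)%:R = (n./2)%:R + (odd n)%:R :> R.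
  by rewrite uphalf_half natrD addrC.
have A_ge : (3 < n)%N -> 2 <= (n./2)%:R :> R.
  by move=> n4; rewrite (ler_nat R 2) geq_half_double.
case: (boolP (odd n)) BE => [n_odd|n_even] BE; last first.
  have {}A_ge : 2 <= (n./2)%:R :> R.
    by apply: A_ge; rewrite ltn_neqAle hn andbT; apply: contraNneq n_even => <-.
  apply: le_trans even_ge; rewrite addr0 in BE; rewrite nA BE in upper *.
  (* The value of [c] is [t - n], nonnegative because [n >= 4]. *)
  move: (n./2%:R : R) A_ge (upper ((n./2)%:R - 2)) => A A2 {}upper.
  have half : 2 * A * A / (A + A) = A by field; rewrite gt_eqF //; lra.
  rewrite half in upper.
  by apply: le_trans (upper _ _) _; lra.
(* For [n = 3] one has [t < n], so [c = 0] and the energy is at most [2 t = 16 / 3]; the sides of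
   [G] necessarily have sizes [1] and [2]. *)
have [n3|n_neq3] := eqVneq n 3%N.
  rewrite n3 in xy upper twice *.
  have xyE : x = 1%N /\ y = 2%N.
    by move: xy x0 xley; case: (x) => [|[|k]]; case: (y) => [|[|[|[|l]]]]; rewrite ?addnS.
  have [A1 B2] : (3./2)%:R = 1 :> R /\ (uphalf 3)%:R = 2 :> R by [].
  rewrite A1 B2 in upper.
  case: xyE twice => -> -> twice; apply: le_trans twice.
  by apply: le_trans (upper 0 _ _) _; lra.
apply: le_trans (odd_ge _); last by rewrite xy.
have {}A_ge : 2 <= (n./2)%:R :> R.
  by apply: A_ge; rewrite ltn_neqAle eq_sym n_neq3.
rewrite nA BE in upper *.
move: (n./2%:R : R) A_ge upper => A A2 upper.
set N := A + (A + 1).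
have N0 : 0 < N by rewrite /N; lra.
have iN : 0 <= N^-1 by rewrite invr_ge0 ltW.
have prod : 2 * A * (A + 1) / N = N / 2 - N^-1 / 2.
  by rewrite /N; field; rewrite gt_eqF //; lra.
(* Again [c = t - n], and [2 (t + c) = 4 n - 8 + 2 / n]. *)
have := upper (N / 2 - 2 + N^-1 / 2); rewrite -/N prod => h.
by apply: le_trans (h _ _) _; rewrite /N in iN *; lra.
Qed.
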